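(* For all $n\in\mathbb{N}^{>0}$ and $r,t>0$, for all $\delta>0$ there is $\varepsilon>0$ such that the following holds. Let $G$ be a group acting on a set $X$. Suppose there are finite sets $S\subseteq G$ and $A\subseteq X$ satisfying: (1) $\frac1\varepsilon<|A|^{1/r}\leq|S|\leq|A|^r$; (2) $|\{(a_1,\ldots,a_n)\in A^n:|\mathrm{Stab}_{\langle S\rangle}(a_1,\ldots,a_n)|\geq|A|^t\}|\leq|A|^{n-\delta}$, where $\langle S\rangle$ is the group generated by $S$; (3) $|\{(s,a,b)\in S\times A\times A: s*a=b\}|\geq|S||A|^{1-\varepsilon}$. Then there exist a finite $|A|^\delta$-approximate subgroup $H\subseteq G$ and a subset $T\subseteq A$ such that: (1) $|H|\leq|A|^{n+t+\delta}$, and $|H\cap h\cdot S|\geq|A|^{-\delta}|S|$ for some $h\in G$; (2) $|T|\geq|A|^{1-\delta}$; (3) $|H*T|\leq|A|^{1+\delta}$.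
   Context: $g*x$ denotes the action of $g\in G$ on $x\in X$, and $H*T=\{h*x:h\in H,\ x\in T\}$. $\mathrm{Stab}_{\langle S\rangle}(a_1,\ldots,a_n)$ is the set of elements of $\langle S\rangle$ fixing each of $a_1,\ldots,a_n$. For a real $k\geq1$, a finite subset $H$ of a group $G$ is a $k$-approximate subgroup if $1\in H$, $H=H^{-1}$, and there is $Z\subseteq G$ with $|Z|\leq k$ and $H\cdot H\subseteq Z\cdot H$. *)

(* Defs.v *)
From HB Require Import structures.
From mathcomp Require Import all_boot all_order all_algebra.
From mathcomp Require Import finmap.
From mathcomp Require Import all_classical all_reals all_analysis.

Set Implicit Arguments.
Unset Strict Implicit.
Unset Printing Implicit Defensive.

Import Order.TTheory GRing.Theory Num.Theory.

Local Open Scope classical_set_scope.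
Local Open Scope fset_scope.
Local Open Scope ring_scope.

(* MathComp's fingroup actions require a finite group, and act on the right. *)
Definition is_left_action (G : groupType) (X : Type) (act : G -> X -> X) :=
  (forall x, act 1%g x = x) /\
  (forall g h x, act (g * h)%g x = act g (act h x)).

Definition generated_subgroup (G : groupType) (S : set G) : set G :=
  smallest (fun K : set G => group_closed (mem K)) S.

(* This set may be infinite: its size is taken with the counting measure, which
   is the cardinality on finite sets and +oo on infinite ones. *)
Definition pointwise_stab (G : groupType) (X : eqType) (act : G -> X -> X)
    (K : set G) (a : seq X) : set G :=
  [set g | K g /\ {in a, forall x, act g x = x}].

(* k >= 1 is not required separately: it follows from 1 \in H. *)
Definition approx_subgroup (R : realType) (G : groupType) (k : R)
    (H : {fset G}) :=
  [/\ 1%g \in H,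
      H = [fset h^-1%g | h in H] &
      exists Z : {fset G}, #|` Z|%:R <= k /\
        [fset (x * y)%g | x in H, y in H]
          `<=` [fset (z * h)%g | z in Z, h in H]].

(* Main.v *)
Require Import Defs.
From HB Require Import structures.
From mathcomp Require Import all_boot all_order all_algebra.
From mathcomp Require Import finmap.
From mathcomp Require Import all_classical all_reals all_analysis.
From mathcomp Require Import ring lra.

(* Call g in G popular if g a lies in A for many a in A. If all elements of a
   finite set Y are popular then, by Cauchy-Schwarz, many quotients g^-1 h with
   g, h in Y are popular too. Let Y' be the popular quotients with at least k
   representations, for a k carrying almost all the mass. Either k is close to
   |Y|, and Y has few quotients along a dense graph, or Y' is larger than Y by a
   fixed power of |A|. Starting from S and iterating, the second case cannot
   recur for ever: a set of popular elements of <S> has at most about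
   |A|^(n + t) elements, since an element is determined up to a small stabiliser
   by its action on a typical n-tuple. In the first case the
   Balog-Szemeredi-Gowers and Tao theorems give an approximate subgroup H with a
   left coset x H dense in Y; density is pulled back to S along the iteration,
   and T consists of the points of A sent into A by many g in Y \cap x H.
   All the losses are powers of |A| with exponents chosen small in advance. *)

Set Implicit Arguments.
Unset Strict Implicit.
Unset Printing Implicit Defensive.

Import Order.TTheory GRing.Theory Num.Theory.

Local Open Scope classical_set_scope.
Local Open Scope fset_scope.
Local Open Scope ring_scope.

(** * Counting in finite sequences and Cauchy-Schwarz *)

Lemma sumr_const_seq (R : pzSemiRingType) (T : Type) (s : seq T) (c : R) :
  \sum_(x <- s) c = c * (size s)%:R.
Proof. by rewrite big_tnth sumr_const card_ord mulr_natr. Qed.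

Lemma natr_count (R : pzSemiRingType) (T : Type) (P : pred T) (s : seq T) :
  (count P s)%:R = \sum_(x <- s) (P x)%:R :> R.
Proof. by elim: s => [|x s IH]; rewrite ?big_nil ?big_cons //= natrD IH. Qed.

Lemma exchange_count (R : pzSemiRingType) (T U : Type) (r : T -> U -> bool)
    (s : seq T) (w : seq U) :
  \sum_(x <- s) (count (r x) w)%:R =
  \sum_(y <- w) (count (r^~ y) s)%:R :> R.
Proof.
under eq_bigr do rewrite natr_count.
by rewrite exchange_big; under [RHS]eq_bigr do rewrite natr_count.
Qed.

Lemma count_inj (T U : eqType) (f : T -> U) (s : seq T) (w : seq U)
    (P : pred T) (Q : pred U) :
    uniq s ->
    {in [pred x in s | P x] &, injective f} ->
    (forall x, x \in s -> P x -> f x \in w /\ Q (f x)) ->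
  (count P s <= count Q w)%N.
Proof.
move=> us finj fw; rewrite -!size_filter -(size_map f).
apply: uniq_leq_size.
  rewrite map_inj_in_uniq ?filter_uniq // => x y.
  rewrite !mem_filter => /andP[Px xs] /andP[Py ys].
  by apply: finj; rewrite inE ?xs ?ys.
move=> _ /mapP[x + ->]; rewrite mem_filter => /andP[Px /fw/(_ Px)[fxw Qfx]].
by rewrite mem_filter Qfx.
Qed.

(** Fibres over distinct entries of [s] are disjoint, so their sizes add up. This bounds the size of
    a set each of whose elements has many representations. *)
Lemma fiber_count (R : numDomainType) (T : eqType) (U : Type) (s : seq T)
    (w : seq U) (P : pred T) (f : U -> T) (m : R) :
    uniq s ->
    (forall x, x \in s -> P x -> m <= (count (fun u => f u == x) w)%:R) ->
  m * (count P s)%:R <= (count (fun u => P (f u)) w)%:R.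
Proof.
move=> us fm.
have -> : m * (count P s)%:R = \sum_(x <- s | P x) m.
  by rewrite -big_filter sumr_const_seq size_filter.
apply: (@le_trans _ _ (\sum_(x <- s | P x) (count (fun u => f u == x) w)%:R)).
  rewrite big_seq_cond [leRHS]big_seq_cond.
  by apply: ler_sum => x /andP[xs Px]; exact: fm.
rewrite -big_filter (exchange_count R (fun x u => f u == x)) natr_count.
apply: ler_sum => u _; rewrite count_filter ler_nat.
case: (P (f u)) / boolP => Pfu.
  apply: (@leq_trans (count_mem (f u) s)); last by rewrite count_uniq_mem ?leq_b1.
  by apply: sub_count => x /andP[/eqP-> _] /=.
rewrite leqn0 -leqn0 leqNgt -has_count; apply/hasPn => x _ /=.
by apply/negP => /andP[/eqP <-]; exact/negP.
Qed.

Lemma sum_sqr_ge (R : realFieldType) (T : Type) (s : seq T) (F : T -> R) :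
  (\sum_(x <- s) F x) ^+ 2 <= (size s)%:R * \sum_(x <- s) F x ^+ 2.
Proof.
elim: s => [|x s IH]; first by rewrite !big_nil expr0n mul0r.
rewrite !big_cons /= -natr1; move: IH.
have : 0 <= \sum_(x <- s) F x ^+ 2 by apply: sumr_ge0 => ? _; exact: sqr_ge0.
move: (\sum_(_ <- _) _) (\sum_(_ <- _) _) => /= A Q Q0.
have := ler0n R (size s); move: (size s)%:R => N N0 IH.
have [N_eq0|N_neq0] := eqVneq N 0.
  move: IH; rewrite N_eq0 mul0r -[leRHS]/(0 : R) real_exprn_even_le0 ?num_real //=.
  by move=> /eqP ->; lra.
have NP : 0 < N by rewrite lt_neqAle eq_sym N_neq0.
(* After multiplication by [N], the induction hypothesis reduces the claim to the positivity of this
   square. *)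
rewrite -subr_ge0 -(pmulr_rge0 _ NP).
have := sqr_ge0 (N * F x - A); nra.
Qed.

(** Cauchy-Schwarz for the degrees of the points of [w]: the square of the degree of [u] counts the
    pairs of entries of [s] both related to [u]. *)
Lemma count_common_ge (R : realFieldType) (T U : Type) (r : T -> U -> bool)
    (s : seq T) (w : seq U) :
  (\sum_(x <- s) (count (r x) w)%:R) ^+ 2 <=
  (size w)%:R *
    \sum_(x <- s) \sum_(y <- s) (count (fun u => r x u && r y u) w)%:R :> R.
Proof.
rewrite exchange_count (le_trans (sum_sqr_ge _ _)) // ler_wpM2l //.
under [leRHS]eq_bigr do under eq_bigr do rewrite natr_count.
under [leRHS]eq_bigr do rewrite exchange_big.
rewrite [leRHS]exchange_big /=; apply: ler_sum => u _.
rewrite expr2 !natr_count mulr_suml; apply: ler_sum => x _.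
rewrite mulr_sumr; apply: ler_sum => y _.
by rewrite -natrM mulnb.
Qed.

Lemma exists_ge_average (R : realDomainType) (T : eqType) (s : seq T)
    (F : T -> R) (c : R) :
  (0 < size s)%N -> c * (size s)%:R <= \sum_(x <- s) F x ->
  exists2 x, x \in s & c <= F x.
Proof.
move=> s0 cs.
case: (hasP (a := fun x => c <= F x) (s := s)) => [[x xs cx]|nex]; first by exists x.
have lt_c x : x \in s -> F x < c.
  by move=> xs; rewrite ltNge; apply/negP => cx; apply: nex; exists x.
suff: \sum_(x <- s) F x < c * (size s)%:R by rewrite ltNge cs.
case: s s0 {cs nex} lt_c => // x s _ lt_c.
have -> : c * (size (x :: s))%:R = \sum_(y <- x :: s) c.
  by rewrite sumr_const_seq.
rewrite !big_cons; apply: ltr_leD; first by rewrite lt_c ?mem_head.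
rewrite big_seq [leRHS]big_seq; apply: ler_sum => y ys.
by rewrite ltW // lt_c // inE ys orbT.
Qed.

(** The entries with [F x < c / 2] contribute at most half of the guaranteed total. *)
Lemma popular_count (R : realFieldType) (T : eqType) (s : seq T) (F : T -> R)
    (c M : R) :
    0 <= c -> (forall x, x \in s -> F x <= M) ->
    c * (size s)%:R <= \sum_(x <- s) F x ->
  c / 2 * (size s)%:R <= M * (count (fun x => c / 2 <= F x) s)%:R.
Proof.
move=> c0 FM cs.
have : \sum_(x <- s) F x <=
    c / 2 * (size s)%:R + M * (count (fun x => c / 2 <= F x) s)%:R.
  have -> : c / 2 * (size s)%:R = \sum_(y <- s) (c / 2).
    by rewrite sumr_const_seq.
  rewrite natr_count mulr_sumr -big_split /= big_seq [leRHS]big_seq.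
  apply: ler_sum => x /FM FxM; case: (leP (c / 2) (F x)) => /= Fx.
    by rewrite mulr1; lra.
  by rewrite mulr0 addr0 ltW.
have := ler0n R (size s); nra.
Qed.

(** * The Balog-Szemeredi-Gowers theorem *)

(* [B] is the set of well-connected vertices in a neighbourhood of some [v]: by
   averaging, [v] may be chosen so that few pairs of its neighbours have few
   common neighbours, and two vertices of [B] are then joined by many paths of
   length 4, through a vertex [y] that is good for both. *)
Lemma bsg_graph (R : realFieldType) (T : eqType) (Y : seq T) (E : rel T)
    (K : R) :
    0 < K -> uniq Y -> (0 < size Y)%N ->
    (size Y)%:R ^+ 2 <= K * \sum_(x <- Y) (count (E x) Y)%:R ->
  exists B : seq T,
    [/\ uniq B, {subset B <= Y}, (size Y)%:R <= 4 * K * (size B)%:R &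
      forall b b', b \in B -> b' \in B ->
        (size Y)%:R ^+ 3 <= 2 ^+ 10 * K ^+ 5 *
          \sum_(y <- Y) (count (fun u => E b u && E y u) Y)%:R *
                        (count (fun u => E b' u && E y u) Y)%:R].
Proof.
move=> K0 uY sY; set N := (size Y)%:R => NK.
have N0 : 0 < N by rewrite ltr0n.
pose codeg x y := count (fun u => E x u && E y u) Y.
(* With this threshold the bad pairs, summed over all [v], number at most [th * N ^+ 3], a sixteenth
   of the lower bound for the sum of the [d v ^+ 2]. *)
pose th : R := (16 * K ^+ 2)^-1.
have th0 : 0 < th by rewrite invr_gt0 mulr_gt0 // exprn_gt0.
have thK : th * (16 * K ^+ 2) = 1 by rewrite mulVf // gt_eqF // mulr_gt0 // exprn_gt0.
pose bad x y := (codeg x y)%:R < th * N.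
pose nb v := \sum_(x <- Y) \sum_(y <- Y) (E x v && E y v && bad x y)%:R : R.
pose d v := (count (E^~ v) Y)%:R : R.
have sum_nb : \sum_(v <- Y) nb v <= th * N ^+ 3.
  rewrite /nb exchange_big /=.
  under eq_bigr do rewrite exchange_big /=.
  have -> : th * N ^+ 3 = \sum_(x <- Y) \sum_(y <- Y) (th * N).
    under eq_bigr do rewrite sumr_const_seq.
    by rewrite sumr_const_seq -/N; ring.
  apply: ler_sum => x _; apply: ler_sum => y _; case: (boolP (bad x y)) => bxy.
    under eq_bigr do rewrite andbT.
    by rewrite -natr_count ltW.
  under eq_bigr do rewrite andbF.
  by rewrite big1_eq mulr_ge0 // ltW.
have sum_d : N ^+ 3 <= K ^+ 2 * \sum_(v <- Y) d v ^+ 2.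
  have := sum_sqr_ge Y d; rewrite -/N /d -(exchange_count R E) => h.
  move: NK h; set e := \sum_(_ <- _) _; set q := \sum_(_ <- _) _ => NK h.
  have e0 : 0 <= e by apply: sumr_ge0.
  have : (N ^+ 2) ^+ 2 <= (K * e) ^+ 2 by rewrite ler_sqr ?nnegrE ?exprn_ge0 ?mulr_ge0 // ltW.
  move=> h2; rewrite -(ler_pM2l N0).
  have -> : N * N ^+ 3 = (N ^+ 2) ^+ 2 by ring.
  apply: le_trans h2 _; rewrite exprMn.
  rewrite [leRHS](_ : _ = K ^+ 2 * (N * q)); last by ring.
  by rewrite ler_wpM2l // exprn_ge0 // ltW.
(* One average gives both properties of [v]: dropping [nb v] shows that its neighbourhood is large,
   dropping the left side that [8 * nb v <= d v ^+ 2]. *)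
have [v vY Fv] : exists2 v, v \in Y & 8 * th * N ^+ 2 <= d v ^+ 2 - 8 * nb v.
  apply: exists_ge_average => //; rewrite -/N.
  have -> : \sum_(x <- Y) (d x ^+ 2 - 8 * nb x) =
      \sum_(x <- Y) d x ^+ 2 - 8 * \sum_(x <- Y) nb x.
    by rewrite mulr_sumr -sumrB.
  have : th * 16 * N ^+ 3 <= \sum_(v <- Y) d v ^+ 2.
    rewrite -(ler_pM2l (exprn_gt0 2 K0)) (le_trans _ sum_d) //.
    rewrite [leLHS](_ : _ = th * (16 * K ^+ 2) * N ^+ 3); last by ring.
    by rewrite thK mul1r.
  move: sum_nb; nra.
pose B := [seq x <- Y | E x v].
have dB : d v = (size B)%:R by rewrite /d /B size_filter.
have nbB : nb v = \sum_(x <- B) (count (bad x) B)%:R.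
  rewrite /nb big_filter [RHS]big_mkcond; apply: eq_bigr => x _.
  case: (E x v) => /=; last by rewrite big1_eq.
  rewrite natr_count big_filter [RHS]big_mkcond; apply: eq_bigr => y _.
  by case: (E y v).
have nb0 : 0 <= nb v by rewrite nbB sumr_ge0.
have size_B : N <= 2 * K * (size B)%:R.
  rewrite -dB -(@ler_sqr _ N) ?nnegrE ?mulr_ge0 ?(ltW K0) ?(ltW N0) //.
  have : K ^+ 2 * (8 * th * N ^+ 2) <= K ^+ 2 * d v ^+ 2.
    rewrite ler_wpM2l ?exprn_ge0 ?(ltW K0) //.
    by rewrite (le_trans Fv) // gerBl mulr_ge0.
  rewrite [leLHS](_ : _ = (th * (16 * K ^+ 2)) * N ^+ 2 / 2); last by field.
  rewrite thK mul1r (_ : (2 * K * d v) ^+ 2 = 4 * (K ^+ 2 * d v ^+ 2)); last by ring.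
  by have := sqr_ge0 N; lra.
have B0 : 0 < (size B)%:R :> R.
  by move: size_B; rewrite lt_neqAle ler0n andbT eq_sym; case: eqVneq => // ->; lra.
have nbB8 : 8 * nb v <= (size B)%:R ^+ 2.
  rewrite -dB -subr_ge0 (le_trans _ Fv) //.
  by rewrite !mulr_ge0 ?exprn_ge0 ?(ltW th0) ?(ltW N0).
pose good x := (count (bad x) B)%:R <= (size B)%:R / 4 :> R.
exists [seq x <- B | good x]; split.
- by rewrite !filter_uniq.
- by move=> x; rewrite !mem_filter => /and3P[].
(* A vertex that is not good has more than [size B / 4] bad partners, so the bound on [nb v] leaves
   at most half of the neighbourhood not good. *)
- have : (count (predC good) B)%:R * ((size B)%:R / 4) <= nb v.
    rewrite nbB natr_count mulr_suml; apply: ler_sum => x _.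
    rewrite /=; case: (boolP (good x)) => [_|]; first by rewrite mul0r.
    by rewrite -ltNge mul1r => /ltW.
  have := count_predC good B; rewrite size_filter => /(congr1 (fun k => k%:R : R)).
  rewrite natrD; move: (count good B)%:R (count (predC good) B)%:R => p q pq qB.
  have : q * (size B)%:R <= (size B)%:R / 2 * (size B)%:R.
    by move: qB nbB8; rewrite expr2; lra.
  rewrite (ler_pM2r B0) => q2.
  apply: le_trans size_B _.
  have : (size B)%:R <= 2 * p by rewrite -pq in q2 *; lra.
  by move=> h; have := ler_wpM2l (ltW K0) h; lra.
move=> b b'; rewrite !mem_filter => /andP[gb _] /andP[gb' _].
(* Each of [b] and [b'] excludes at most a quarter of the neighbourhood, so at least half of it is
   [ok]; every such [y] carries at least [(th * N) ^+ 2] paths. *)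
pose ok y := ~~ bad b y && ~~ bad b' y.
have okB : (size B)%:R <= 2 * (count ok Y)%:R :> R.
  have le1 : (count ok B)%:R <= (count ok Y)%:R :> R.
    by rewrite ler_nat count_filter; apply: sub_count => x /andP[].
  have : (size B)%:R <= (count ok B)%:R + (count (bad b) B)%:R + (count (bad b') B)%:R :> R.
    rewrite -!natrD ler_nat -(count_predC ok B) -addnA leq_add2l.
    rewrite -count_predUI (leq_trans _ (leq_addr _ _)) //.
    by apply: sub_count => x /=; rewrite /ok -negb_or negbK.
  by move: gb gb'; rewrite /good; lra.
have : (th * N) ^+ 2 * (count ok Y)%:R <=
    \sum_(y <- Y) (codeg b y)%:R * (codeg b' y)%:R.
  rewrite natr_count mulr_sumr; apply: ler_sum => y _.
  rewrite /ok /bad -!leNgt; case: andP => [[h1 h2]|_]; last by rewrite mulr0 mulr_ge0.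
  by rewrite mulr1 expr2 ler_pM // mulr_ge0 // ltW.
move: okB; rewrite -/codeg; set S := \sum_(_ <- _) _.
move: (count ok Y)%:R => c okB h.
have h1 : N <= 4 * K * c by have := ler_wpM2l (ltW K0) okB; lra.
have h2 := ler_wpM2l (exprn_ge0 5 (ltW K0)) h.
have h3 := ler_wpM2l (exprn_ge0 2 (ltW N0)) h1.
have : K ^+ 5 * ((th * N) ^+ 2 * c) * 256 = (th * (16 * K ^+ 2)) ^+ 2 * (N ^+ 2 * K * c) by ring.
rewrite thK expr1n mul1r => h4.
rewrite [N ^+ 3](_ : _ = N ^+ 2 * N); last by ring.
lra.
Qed.

Lemma natr_count_allpairs (R : pzSemiRingType) (T U : Type) (P : pred (T * U))
    (s : seq T) (w : seq U) :
  (count P [seq (x, y) | x <- s, y <- w])%:R =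
  \sum_(x <- s) (count (fun y => P (x, y)) w)%:R :> R.
Proof.
by rewrite natr_count big_allpairs; under [RHS]eq_bigr do rewrite natr_count.
Qed.

Lemma uniq_pairs (T U : eqType) (s : seq T) (w : seq U) :
  uniq s -> uniq w -> uniq [seq (x, y) | x <- s, y <- w].
Proof. by move=> us uw; apply: allpairs_uniq => // -[? ?] [? ?] _ _ [-> ->]. Qed.

Lemma mem_pairs (T U : eqType) (s : seq T) (w : seq U) (x : T) (y : U) :
  ((x, y) \in [seq (a, b) | a <- s, b <- w]) = (x \in s) && (y \in w).
Proof.
apply/allpairsP/andP => [[[a b] /= [? ? [-> ->]]] //|[xs yw]].
by exists (x, y).
Qed.

(** A path from [b] through [u], [y], [v] to [c] writes [b^-1 * c] as [(b^-1 * u) * (y^-1 * u)^-1 *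
    (y^-1 * v) * (c^-1 * v)^-1], with four quotients in [D]. Distinct paths give distinct
    quadruples, so the number of quotients times the number of paths is at most [(size D) ^+ 4]. *)
Lemma bsg_diff (R : realFieldType) (G : groupType) (Y D : seq G) (K : R) :
    0 < K -> uniq Y -> (0 < size Y)%N ->
    (size D)%:R <= K * (size Y)%:R ->
    (size Y)%:R ^+ 2 <=
      K * \sum_(x <- Y) (count (fun y => (x^-1 * y)%g \in D) Y)%:R ->
  exists B : seq G,
    [/\ uniq B, {subset B <= Y}, (size Y)%:R <= 4 * K * (size B)%:R &
      (size (undup [seq (b^-1 * c)%g | b <- B, c <- B]))%:R <=
        2 ^+ 12 * K ^+ 10 * (size B)%:R].
Proof.
move=> K0 uY sY DK /(bsg_graph K0 uY sY)[B [uB BY YB tri]].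
exists B; split=> //; set Q := undup _.
have N0 : 0 < (size Y)%:R :> R by rewrite ltr0n.
pose DD := [seq (d, e) | d <- D, e <- D].
pose w := [seq (p, q) | p <- DD, q <- DD].
pose f (z : G * G * (G * G)) := (z.1.1 * z.1.2^-1 * (z.2.1 * z.2.2^-1))%g.
pose m : R := (size Y)%:R ^+ 3 / (2 ^+ 10 * K ^+ 5).
have K5 : 0 < 2 ^+ 10 * K ^+ 5 by rewrite mulr_gt0 ?exprn_gt0.
have fib q : q \in Q -> true -> m <= (count (fun z => f z == q) w)%:R.
  rewrite mem_undup => /allpairsP[[b b'] /= [bB b'B ->]] _.
  rewrite /m ler_pdivrMr // [leRHS]mulrC.
  apply: le_trans (tri b b' bB b'B) _; rewrite ler_wpM2l ?(ltW K5) //.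
  pose E (x y : G) := (x^-1 * y)%g \in D.
  pose t := [seq (y, p) | y <- Y, p <- [seq (u, v) | u <- Y, v <- Y]].
  pose P (z : G * (G * G)) :=
    (E b z.2.1 && E z.1 z.2.1) && (E b' z.2.2 && E z.1 z.2.2).
  rewrite [leLHS](_ : _ = (count P t)%:R); last first.
    rewrite natr_count_allpairs; apply: eq_bigr => y _.
    rewrite natr_count_allpairs !natr_count mulr_suml; apply: eq_bigr => u _.
    rewrite mulr_sumr natr_count; apply: eq_bigr => v _.
    by rewrite -natrM mulnb.
  rewrite ler_nat.
  apply: (@count_inj _ _ (fun z : G * (G * G) => 
    (((b^-1 * z.2.1)%g, (z.1^-1 * z.2.1)%g),
     ((z.1^-1 * z.2.2)%g, (b'^-1 * z.2.2)%g)))).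
  - by rewrite !uniq_pairs.
  - move=> [y [u v]] [y' [u' v']] _ _ /= [/mulgI -> + _ /mulgI ->].
    by move=> /mulIg/invg_inj ->.
  - move=> [y [u v]] _ /andP[/andP[h1 h2] /andP[h3 h4]].
    rewrite /w /DD !mem_pairs /=; split.
      by move: h1 h2 h3 h4; rewrite /E /= => -> -> -> ->.
    by rewrite /f /= !invgM !invgK !mulgA !mulgK.
have := fiber_count (undup_uniq _) fib.
rewrite !count_predT /w /DD !size_allpairs !natrM.
have d0 : 0 <= (size D)%:R :> R by [].
move: (size D)%:R d0 (size Q)%:R (size B)%:R DK YB => d d0 q c dN Nc.
rewrite /m mulrAC ler_pdivrMr //.
move: (size Y)%:R N0 dN Nc => N N0 dN Nc h.
have d4 : d ^+ 4 <= (K * N) ^+ 4 by rewrite lerXn2r ?nnegrE ?mulr_ge0 ?(ltW K0) ?(ltW N0).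
rewrite -(ler_pM2l (exprn_gt0 3 N0)) (le_trans h) //.
have -> : d * d * (d * d) = d ^+ 4 by ring.
apply: (@le_trans _ _ ((K * N) ^+ 4 * (2 ^+ 10 * K ^+ 5))).
  by rewrite ler_wpM2r // ltW.
have -> : (K * N) ^+ 4 * (2 ^+ 10 * K ^+ 5) = N ^+ 3 * (2 ^+ 10 * K ^+ 9 * N) by ring.
rewrite ler_pM2l ?exprn_gt0 //.
have -> : 2 ^+ 12 * K ^+ 10 * c = 2 ^+ 10 * K ^+ 9 * (4 * K * c) by ring.
by rewrite ler_wpM2l // mulr_ge0 // exprn_ge0 // ltW.
Qed.

(** * Product sets and Ruzsa covering *)

Definition prods (G : groupType) (U V : seq G) : seq G :=
  undup [seq (u * v)%g | u <- U, v <- V].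

Lemma prodsP (G : groupType) (U V : seq G) (x : G) :
  reflect (exists u v, [/\ u \in U, v \in V & x = (u * v)%g]) (x \in prods U V).
Proof.
rewrite mem_undup; apply: (iffP idP) => [/allpairsP[[u v] /=]|[u [v]]]; first by exists u, v.
by move=> ?; apply/allpairsP; exists (u, v).
Qed.

Lemma mem_prods (G : groupType) (U V : seq G) (u v : G) :
  u \in U -> v \in V -> (u * v)%g \in prods U V.
Proof. by move=> uU vV; apply/prodsP; exists u, v. Qed.

(** Greedy choice: [w] joins [Z] unless its translate of [S] meets that of some [z] already chosen.
    A maximal family of disjoint translates covers [W] by the sets [z S S^-1]. *)
Lemma ruzsa_covering (G : groupType) (W S : seq G) (s0 : G) :
    s0 \in S ->
  exists Z : seq G,
    [/\ uniq Z, {subset Z <= W},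
      forall z z' s s', z \in Z -> z' \in Z -> s \in S -> s' \in S ->
        (z * s)%g = (z' * s')%g -> z = z' &
      forall w, w \in W ->
        exists z s s', [/\ z \in Z, s \in S, s' \in S & (w * s' = z * s)%g]].
Proof.
move=> s0S; elim: W => [|w W [Z [uZ ZW injZ covZ]]]; first by exists [::].
have [[z [s [s' [zZ sS s'S e]]]]|nocov] :=
    pselect (exists z s s', [/\ z \in Z, s \in S, s' \in S & (w * s' = z * s)%g]).
  exists Z; split=> // [x /ZW xW|v]; first by rewrite inE xW orbT.
  by rewrite inE => /orP[/eqP ->|/covZ //]; exists z, s, s'.
exists (w :: Z); split.
- rewrite /= uZ andbT; apply/negP => wZ.
  by apply: nocov; exists w, s0, s0.
- by move=> x; rewrite !inE => /orP[->//|/ZW ->]; rewrite orbT.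
- move=> z z' s s'; rewrite !inE => /orP[/eqP ->|zZ] /orP[/eqP ->|z'Z] // sS s'S e.
  + by case: nocov; exists z', s', s.
  + by case: nocov; exists z, s, s'.
  + exact: injZ e.
- move=> v; rewrite inE => /orP[/eqP ->|/covZ].
    by exists w, s0, s0; rewrite mem_head.
  by move=> [z [s [s' [zZ ? ? ?]]]]; exists z, s, s'; rewrite inE zZ orbT.
Qed.

Lemma card_imfset_seq_le (T U : choiceType) (f : T -> U) (s : seq T) :
  (#|` [fset f x | x in s]| <= size s)%N.
Proof.
rewrite -(size_map f); apply: uniq_leq_size; first exact: fset_uniq.
by move=> _ /imfsetP[x /= xs ->]; rewrite map_f.
Qed.

(** * From few quotients to an approximate subgroup *)

Section SmallDifference.
Variables (R : realType) (G : groupType) (B : seq G) (K : R).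
Hypotheses (uB : uniq B) (sB : (0 < size B)%N) (K1 : 1 <= K).

Let P := undup [seq (b^-1 * c)%g | b <- B, c <- B].
Hypothesis PK : (size P)%:R <= K * (size B)%:R.

Let rep (x : G) : R :=
  (count (fun p => (p.1 * p.2^-1)%g == x) [seq (b, c) | b <- B, c <- B])%:R.

(** The threshold is half the lower bound that Cauchy-Schwarz gives for the average of
    [rep (b * c^-1)]. This set is symmetric and contains 1, as [B] need not be. *)
Let S := [seq x <- undup [seq (b * c^-1)%g | b <- B, c <- B] |
           (size B)%:R / K / 2 <= rep x].

Let B0 : 0 < (size B)%:R :> R. Proof. by rewrite ltr0n. Qed.
Let K0 : 0 < K. Proof. exact: lt_le_trans ltr01 K1. Qed.

Let rep_le x : rep x <= (size B)%:R.
Proof.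
rewrite ler_nat -(count_predT B); apply: (count_inj (f := fun p => p.1)).
- exact: uniq_pairs.
- move=> [b c] [b' c'] /andP[_ /= /eqP e] /andP[_ /= /eqP e'] /= bb'.
  by move: e; rewrite -e' bb' => /mulgI/invg_inj ->.
- by move=> [b c]; rewrite mem_pairs => /andP[].
Qed.

Let repV x : rep x <= rep x^-1%g.
Proof.
rewrite ler_nat; apply: (count_inj (f := fun p => (p.2, p.1))).
- exact: uniq_pairs.
- by move=> [b c] [b' c'] _ _ [-> ->].
- move=> [b c]; rewrite !mem_pairs => /andP[-> ->] /= /eqP <-.
  by rewrite invgM invgK.
Qed.

Let mem_S x : (size B)%:R / K / 2 <= rep x -> x \in S.
Proof.
move=> h; rewrite mem_filter h /= mem_undup.
have : 0 < rep x by apply: lt_le_trans h; rewrite !divr_gt0.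
rewrite ltr0n -has_count => /hasP[[b c]]; rewrite mem_pairs => /andP[bB cB] /= /eqP <-.
by apply/allpairsP; exists (b, c).
Qed.

Let rep_S x : x \in S -> (size B)%:R / K / 2 <= rep x.
Proof. by rewrite mem_filter => /andP[]. Qed.

Let S_inv x : x \in S -> x^-1%g \in S.
Proof. by move=> /rep_S h; apply: mem_S; apply: le_trans (repV x). Qed.

Let S_one : 1%g \in S.
Proof.
apply: mem_S; apply: (@le_trans _ _ (size B)%:R).
  rewrite -mulrA ler_piMr // -invfM invf_le1 ?mulr_gt0 //.
  by have := K1; lra.
rewrite ler_nat -(count_predT B); apply: (count_inj (f := fun b => (b, b))) => //.
  by move=> b c _ _ [].
by move=> b bB _; rewrite mem_pairs bB /= mulgV.
Qed.

(* Writing [s = c c'^-1] in many ways, [u s b = (u c) (c'^-1 b)] is a product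
   of an element of [U B] and one of [P] in as many ways. *)
Let prods_SB (U : seq G) :
  (size (prods (prods U S) B))%:R <= 2 * K ^+ 2 * (size (prods U B))%:R.
Proof.
pose w := [seq (x, y) | x <- prods U B, y <- P].
have fib q : q \in prods (prods U S) B -> true ->
    (size B)%:R / K / 2 <= (count (fun z => (z.1 * z.2)%g == q) w)%:R.
  move=> /prodsP[_ [b [/prodsP[u [s [uU /rep_S h ->]]] bB ->]]] _.
  apply: le_trans h _; rewrite ler_nat.
  apply: (count_inj (f := fun p => ((u * p.1)%g, (p.2^-1 * b)%g))).
  - exact: uniq_pairs.
  - by move=> [? ?] [? ?] _ _ /= [/mulgI -> /mulIg/invg_inj ->].
  - move=> [c c']; rewrite !mem_pairs => /andP[cB c'B] /= /eqP <-.
    rewrite mem_prods //= mem_undup !mulgA; split=> //.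
    by apply/allpairsP; exists (c', b).
have := fiber_count (undup_uniq _) fib.
rewrite !count_predT size_allpairs natrM.
move=> h; have h2 : (size (prods U B))%:R * (size P)%:R <=
    (size (prods U B))%:R * (K * (size B)%:R) by rewrite ler_wpM2l.
have := le_trans h h2.
move: (size (prods _ _))%:R (size (prods _ _))%:R => p q {}h.
rewrite -(ler_pM2l (_ : 0 < (size B)%:R / K / 2)) ?divr_gt0 //.
rewrite (le_trans h) // le_eqVlt; apply/orP; left; apply/eqP; field.
by rewrite gt_eqF.
Qed.

Let size_le_prods (U : seq G) : uniq U -> (size U <= size (prods U B))%N.
Proof.
move=> uU; case: (B) sB => // b B' _.
rewrite -(size_map (fun u => (u * b)%g) U); apply: uniq_leq_size.
  by rewrite map_inj_uniq //; exact: mulIg.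
by move=> _ /mapP[u uU' ->]; rewrite mem_prods ?mem_head.
Qed.

Let size_prods1 : (size (prods [:: 1%g] B) <= size B)%N.
Proof.
rewrite uniq_leq_size ?undup_uniq // => x /prodsP[u [b [+ bB ->]]].
by rewrite inE => /eqP ->; rewrite mul1g.
Qed.

Let U := fix U i := if i is j.+1 then prods (U j) S else [:: 1%g].

(** Multiply by [B] on the right, then remove the factors [S] one at a time by [prods_SB]; each
    costs [2 * K ^+ 2]. *)
Let size_U i : (size (U i))%:R <= (2 * K ^+ 2) ^+ i * (size B)%:R.
Proof.
have uU : uniq (U i) by case: i => //= i; exact: undup_uniq.
apply: (@le_trans _ _ (size (prods (U i) B))%:R); first by rewrite ler_nat size_le_prods.
elim: i {uU} => [|i IH]; first by rewrite expr0 mul1r ler_nat size_prods1.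
rewrite (le_trans (prods_SB _)) // [_ ^+ i.+1]exprS -[leRHS]mulrA ler_wpM2l //.
by rewrite mulr_ge0 // exprn_ge0 // ltW.
Qed.

Let mem_U i x s : x \in U i -> s \in S -> (x * s)%g \in U i.+1.
Proof. by move=> xU sS; rewrite mem_prods. Qed.

(** Relate [b] to those [x] in [P] with [b * x] in [B]. A common [x] of [b] and [c] represents
    [b * c^-1] as [(b * x) * (c * x)^-1], so Cauchy-Schwarz over the small set [P] makes
    [rep (b * c^-1)] at least [size B / K] on average. Many pairs then have their quotient in [S],
    and averaging fixes the second entry. *)
Let popular_base : exists2 b0, b0 \in B &
  (size B)%:R <= 2 * K * (count (fun b => (b * b0^-1)%g \in S) B)%:R.
Proof.
pose r (b x : G) := (b * x)%g \in B.
have cr b : b \in B -> (size B)%:R <= (count (r b) P)%:R :> R.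
  move=> bB; rewrite ler_nat -(count_predT B).
  apply: (count_inj (f := fun c => (b^-1 * c)%g)) => //.
    by move=> ? ? _ _ /mulgI.
  move=> c cB _; rewrite mem_undup /r mulVKg; split=> //.
  by apply/allpairsP; exists (b, c).
have h1 : (size B)%:R * (size B)%:R <= \sum_(b <- B) (count (r b) P)%:R :> R.
  rewrite [leLHS](_ : _ = \sum_(b <- B) (size B)%:R); last first.
    by rewrite sumr_const_seq.
  by rewrite big_seq [leRHS]big_seq; apply: ler_sum => b; exact: cr.
have := count_common_ge R r B P; set e := \sum_(_ <- _) _ in h1 *.
set q := \sum_(_ <- _) \sum_(_ <- _) _ => h2.
have qrep : q <= \sum_(z <- [seq (b, c) | b <- B, c <- B]) rep (z.1 * z.2^-1)%g.
  rewrite big_allpairs; apply: ler_sum => b _; apply: ler_sum => c _ /=.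
  rewrite ler_nat; apply: (count_inj (f := fun x => ((b * x)%g, (c * x)%g))).
  - exact: undup_uniq.
  - by move=> ? ? _ _ [/mulgI].
  - move=> x _ /andP[bx cx]; rewrite mem_pairs /=; split; first exact/andP.
    by rewrite invgM mulgA mulgK.
have q0 : 0 <= q by apply: sumr_ge0 => ? _; apply: sumr_ge0.
have e2 : ((size B)%:R * (size B)%:R) ^+ 2 <= e ^+ 2.
  by rewrite ler_sqr ?nnegrE ?mulr_ge0 // (le_trans _ h1) ?mulr_ge0.
have h3 := le_trans e2 (le_trans h2 (ler_wpM2r q0 PK)).
have h4 : (size B)%:R / K * (size [seq (b, c) | b <- B, c <- B])%:R <= q.
  rewrite size_allpairs natrM mulrAC ler_pdivrMr // -(ler_pM2l B0).
  apply: le_trans (le_trans _ h3) _; rewrite le_eqVlt; apply/orP; left; apply/eqP; ring.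
have := popular_count (divr_ge0 (ltW B0) (ltW K0))
  (fun z _ => rep_le (z.1 * z.2^-1)%g) (le_trans h4 qrep).
rewrite size_allpairs natrM natr_count_allpairs exchange_count => h5.
have [b0 b0B h6] : exists2 b0, b0 \in B & (size B)%:R / K / 2 <=
    (count (fun b => (size B)%:R / K / 2 <= rep (b * b0^-1)%g) B)%:R.
  apply: exists_ge_average => //.
  by rewrite -(ler_pM2l B0) (le_trans _ h5) // le_eqVlt; apply/orP; left; apply/eqP; ring.
exists b0 => //.
have h7 : (size B)%:R / K / 2 <= (count (fun b => (b * b0^-1)%g \in S) B)%:R.
  by rewrite (le_trans h6) // ler_nat; apply: sub_count => b /mem_S.
move: h7; rewrite !ler_pdivrMr //; lra.
Qed.

(* [H] is a conjugate of [S S]: this turns the right coset [S b0], in which [B]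
   is dense, into the left coset [b0 H]. *)
Lemma approx_subgroup_of_small_diff :
  exists (H : {fset G}) (b0 : G),
    [/\ approx_subgroup (64 * K ^+ 11) H,
        #|` H|%:R <= 4 * K ^+ 4 * (size B)%:R &
        (size B)%:R <= 2 * K * (count (fun b => (b0^-1 * b)%g \in H) B)%:R].
Proof.
have [b0 b0B popb0] := popular_base.
pose cj (x : G) := (b0^-1 * x * b0)%g.
have cjM x y : cj (x * y)%g = (cj x * cj y)%g by rewrite /cj !mulgA mulgK.
have cjV x : cj x^-1%g = (cj x)^-1%g by rewrite /cj !invgM invgK mulgA.
pose H := [fset cj x | x in U 2].
have U2P x : reflect (exists s s', [/\ s \in S, s' \in S & x = (s * s')%g]) (x \in U 2).
  apply: (iffP idP) => [/prodsP[_ [s' [/prodsP[e [s [e1 sS ->]]] s'S ->]]]|].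
    by move: e1; rewrite inE => /eqP ->; rewrite mul1g; exists s, s'.
  move=> [s [s' [sS s'S ->]]]; apply/prodsP; exists s, s'; split=> //.
  by have := @mem_U 0 1%g s (mem_head _ _) sS; rewrite mul1g.
have mem_H s s' : s \in S -> s' \in S -> cj (s * s')%g \in H.
  by move=> sS s'S; apply: in_imfset; apply/U2P; exists s, s'.
exists H, b0; split; last 2 first.
- apply: (@le_trans _ _ (size (U 2))%:R).
    by rewrite ler_nat card_imfset_seq_le.
  by rewrite (le_trans (size_U 2)) // le_eqVlt; apply/orP; left; apply/eqP; ring.
- rewrite (le_trans popb0) // ler_wpM2l ?mulr_ge0 ?(ltW K0) // ler_nat.
  apply: sub_count => b /= bS.
  have -> : (b0^-1 * b)%g = cj (b * b0^-1 * 1)%g by rewrite /cj mulg1 mulgA mulgVK.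
  exact: mem_H.
(* The translates of [S] by [Z] are disjoint inside the fifth power of [S], which bounds [Z]. They
   cover the fourth power by [Z S S^-1], which is [Z S S] as [S] is symmetric; conjugation by [cj]
   then covers the product of [H] with itself. *)
have [Z [uZ ZU injZ covZ]] := @ruzsa_covering _ (U 4) _ _ S_one.
have sS : 0 < (size S)%:R :> R.
  by rewrite ltr0n; case: (S) S_one.
have BS : (size B)%:R <= 2 * K * (size S)%:R.
  rewrite (le_trans popb0) // ler_wpM2l ?mulr_ge0 ?(ltW K0) // ler_nat -(count_predT S).
  apply: (count_inj (f := fun b => (b * b0^-1)%g)) => //.
  by move=> ? ? _ _ /mulIg.
have ZS : (size Z * size S <= size (U 5))%N.
  rewrite -(size_allpairs (fun x y => (x * y)%g)); apply: uniq_leq_size.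
    apply: allpairs_uniq => //; first by rewrite filter_uniq ?undup_uniq.
    move=> [z s] [z' s'] /allpairsP[[? ?] /= [zZ sS' [-> ->]]].
    move=> /allpairsP[[? ?] /= [z'Z s'S [-> ->]]] /= e.
    move: (injZ _ _ _ _ zZ z'Z sS' s'S e) => zz'.
    by move: e; rewrite zz' => /mulgI ->.
  by move=> _ /allpairsP[[z s] /= [/ZU zU sS1 ->]]; exact: (@mem_U 4).
split.
- by rewrite (_ : 1%g = cj (1 * 1)%g) ?mem_H // /cj !mulg1 mulVg.
- apply/fsetP => x; apply/imfsetP/imfsetP => /=.
    move=> [y /U2P[s [s' [sS' s'S ->]]] ->]; exists (cj (s'^-1 * s^-1)%g).
      by rewrite mem_H ?S_inv.
    by rewrite -cjV -invgM invgK.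
  move=> [_ /imfsetP[y /= /U2P[s [s' [sS' s'S ->]]] ->] ->].
  exists (s'^-1 * s^-1)%g; last by rewrite -cjV invgM.
  by apply/U2P; exists s'^-1%g, s^-1%g; rewrite !S_inv.
- exists [fset cj z | z in Z]; split.
    apply: (@le_trans _ _ (size Z)%:R).
      by rewrite ler_nat card_imfset_seq_le.
    rewrite -(ler_pM2r sS) -natrM.
    apply: (@le_trans _ _ (size (U 5))%:R); first by rewrite ler_nat.
    rewrite (le_trans (size_U 5)) //.
    rewrite (_ : 64 * K ^+ 11 * _ = (2 * K ^+ 2) ^+ 5 * (2 * K * (size S)%:R)); last by ring.
    by rewrite ler_wpM2l // exprn_ge0 // mulr_ge0 // exprn_ge0 // ltW.
  apply/fsubsetP => x /imfset2P[_ /= /imfsetP[u /= uU ->] [_ /= /imfsetP[v /= vU ->] ->]].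
  have uvU : (u * v)%g \in U 4.
    by move: vU => /U2P[s [s' [sS' s'S ->]]]; rewrite mulgA !mem_U.
  have [z [s [s' [zZ sS' s'S e]]]] := covZ _ uvU.
  apply/imfset2P; exists (cj z); first by apply/imfsetP; exists z.
  exists (cj (s * s'^-1)%g); first by apply: mem_H => //; exact: S_inv.
  by rewrite -!cjM mulgA -e mulgK.
Qed.

End SmallDifference.

(** The two preceding theorems are chained, with [L = K ^+ 22] as the quotient constant of [B]. As
    [2 <= K], numerical factors are absorbed into powers of [K]: the exponents are
    [248 = 6 + 22 * 11], [90 = 2 + 22 * 4] and [26 = 3 + 1 + 22]. *)
Lemma approx_subgroup_of_popular_diff (R : realType) (G : groupType)
    (Y D : seq G) (K : R) :
    2 <= K -> uniq Y -> (0 < size Y)%N ->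
    (size D)%:R <= K * (size Y)%:R ->
    (size Y)%:R ^+ 2 <=
      K * \sum_(x <- Y) (count (fun y => (x^-1 * y)%g \in D) Y)%:R ->
  exists (H : {fset G}) (x : G),
    [/\ approx_subgroup (K ^+ 248) H,
        #|` H|%:R <= K ^+ 90 * (size Y)%:R &
        (size Y)%:R <= K ^+ 26 * (count (fun y => (x^-1 * y)%g \in H) Y)%:R].
Proof.
move=> K2 uY sY DK YK; have K0 : 0 < K by lra.
have K1 : 1 <= K by lra.
have [B [uB BY YB PB]] := bsg_diff K0 uY sY DK YK.
have B0 : 0 < (size B)%:R :> R.
  rewrite lt_neqAle ler0n andbT eq_sym; apply/eqP => B0; move: YB.
  by rewrite B0 mulr0 leNgt ltr0n sY.
have pow2 n : 2 ^+ n <= K ^+ n by rewrite lerXn2r ?nnegrE // ltW.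
have K12 : 2 ^+ 12 * K ^+ 10 <= K ^+ 22.
  by rewrite (_ : 22 = 12 + 10)%N // [leRHS]exprD ler_wpM2r ?exprn_ge0 ?(ltW K0).
set L := K ^+ 22 in K12.
have L1 : 1 <= L by rewrite exprn_ege1.
have PL : (size (undup [seq (b^-1 * c)%g | b <- B, c <- B]))%:R <= L * (size B)%:R.
  by rewrite (le_trans PB) // ler_wpM2r.
have sB : (0 < size B)%N by rewrite -(ltr0n R).
have [H [b0 [appH cH cB]]] := approx_subgroup_of_small_diff uB sB L1 PL.
exists H, b0; split.
- case: appH => H1 HV [Z [cZ sub]]; split=> //; exists Z; split=> //.
  rewrite (le_trans cZ) // /L -exprM (_ : 248 = 6 + 22 * 11)%N // [leRHS]exprD.
  rewrite ler_wpM2r ?exprn_ge0 ?(ltW K0) // (le_trans _ (pow2 6%N)) //; lra.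
- rewrite (le_trans cH) //; apply: ler_pM => //.
  + by rewrite mulr_ge0 // exprn_ge0 // ltW // (lt_le_trans ltr01).
  + rewrite /L -exprM (_ : 90 = 2 + 22 * 4)%N // [leRHS]exprD.
    by rewrite ler_wpM2r ?exprn_ge0 ?(ltW K0) // (le_trans _ (pow2 2%N)) //; lra.
  + by rewrite ler_nat uniq_leq_size.
- apply: le_trans YB _.
  have c0 : 0 <= 4 * K by lra.
  apply: le_trans (ler_wpM2l c0 cB) _.
  rewrite mulrA; apply: ler_pM => //.
  + by rewrite !mulr_ge0 ?(ltW K0) // (le_trans ler01 L1).
  + rewrite (_ : K ^+ 26 = K ^+ 3 * K * L); last by rewrite /L -exprSr -exprD.
    have := pow2 3%N; have L0 : 0 <= L by lra.
    move=> h; have := ler_wpM2r (mulr_ge0 (ltW K0) L0) h; lra.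
  + by rewrite ler_nat; apply: (count_inj (f := id)) => // y /BY.
Qed.

(** * Choice of a popular level by harmonic sums *)

(** The last term [x] is at most the increment of the logarithm, by [ln (1 - x) <= - x]. The empty
    sum fits because [ln 0] is 0 by convention. *)
Lemma harmonic_le (R : realType) (m : nat) :
  \sum_(i < m) (i.+1%:R)^-1 <= 1 + ln (m%:R : R).
Proof.
case: m => [|m]; first by rewrite big_ord0 ln0 ?addr0.
elim: m => [|m IH]; first by rewrite big_ord1 invr1 ln1 addr0.
rewrite big_ord_recr /= (le_trans (lerD IH (lexx _))) // -addrA lerD2l.
have m0 : (0 : R) < m.+1%:R by rewrite ltr0n.
have m1 : (0 : R) < m.+2%:R by rewrite ltr0n.
set x : R := m.+2%:R^-1.
have x1 : x < 1 by rewrite invf_lt1 // ltr1n.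
have lnx : ln (1 + - x) <= - x by rewrite le_ln1Dx // ltrN2.
have -> : ln (m.+1%:R : R) = ln m.+2%:R + ln (1 + - x); last by lra.
rewrite -lnM ?posrE ?subr_gt0 //; congr ln.
by rewrite mulrBr mulr1 /x divff ?gt_eqF // -[m.+2%:R]natr1 addrK.
Qed.

(** The sum of [r] is the sum over [i] of the number of entries with [r x > i]. If each of these
    numbers were at most [c / (L * (i + 1))], the total would be at most [c / L] times the harmonic
    sum, hence below [c]. The loss is thus only logarithmic in [m]. *)
Lemma exists_popular_level (R : realFieldType) (T : eqType) (s : seq T)
    (r : T -> nat) (m : nat) (c L : R) :
    0 < c -> (forall x, x \in s -> (r x <= m)%N) ->
    \sum_(i < m) (i.+1%:R)^-1 < L ->
    c <= \sum_(x <- s) (r x)%:R ->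
  exists2 k, (0 < k)%N & c <= L * k%:R * (count (fun x => (k <= r x)%N) s)%:R.
Proof.
move=> c0 rm HL cs.
have sum_lt k j : (k <= j)%N -> k%:R = \sum_(i < j) (i < k)%N%:R :> R.
  move=> kj; rewrite -natr_sum; congr _%:R.
  rewrite -(subnKC kj) big_split_ord /= [X in (_ + X)%N]big1 ?addn0; last first.
    by move=> i _; rewrite ltnNge leq_addr.
  by under eq_bigr do rewrite ltn_ord; rewrite sum1_card card_ord.
have H0 : 0 <= \sum_(i < m) (i.+1%:R)^-1 :> R by apply: sumr_ge0 => i _; rewrite invr_ge0.
have L0 : 0 < L by apply: le_lt_trans HL.
case: (pselect (exists i : 'I_m, c <= L * i.+1%:R * (count (fun x => (i < r x)%N) s)%:R)).
  by move=> [i ci]; exists i.+1.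
move=> nex; exfalso.
have lt_c (i : 'I_m) : (count (fun x => (i < r x)%N) s)%:R <= c / L * i.+1%:R^-1.
  rewrite ler_pdivlMr ?ltr0n // ler_pdivlMr // ltW // ltNge; apply/negP => h.
  by apply: nex; exists i; rewrite (le_trans h) // le_eqVlt; apply/orP; left; apply/eqP; ring.
suff : c < c by rewrite ltxx.
apply: le_lt_trans cs _.
have -> : \sum_(x <- s) (r x)%:R = \sum_(i < m) (count (fun x => (i < r x)%N) s)%:R :> R.
  rewrite big_seq; under eq_bigr => x xs do rewrite (sum_lt _ _ (rm _ xs)).
  by rewrite -big_seq exchange_big; apply: eq_bigr => i _; rewrite natr_count.
apply: le_lt_trans (ler_sum _ (fun i _ => lt_c i)) _.
by rewrite -mulr_sumr -mulrA gtr_pMr // mulrC ltr_pdivrMr // mul1r.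
Qed.

(** * One step of the iteration *)

Section ActionStep.
Variables (R : realType) (G : groupType) (X : choiceType) (act : G -> X -> X).
Hypothesis actP : is_left_action act.
Variable A : seq X.
Hypothesis uA : uniq A.
Hypothesis sA : (0 < size A)%N.

Let A0 : 0 < (size A)%:R :> R. Proof. by rewrite ltr0n. Qed.

Lemma actK (g : G) : cancel (act g) (act g^-1%g).
Proof. by move=> x; rewrite -(proj2 actP) mulVg (proj1 actP). Qed.

Definition overlap (g : G) : nat := count (fun x => act g x \in A) A.

Lemma overlap_le_inv (g : G) : (overlap g <= overlap g^-1)%N.
Proof.
apply: (count_inj (f := act g)) => // [x y _ _|x xA gxA]; first exact: (can_inj (actK g)).
by rewrite actK.
Qed.

Lemma overlapV (g : G) : overlap g^-1 = overlap g.
Proof. by apply/eqP; rewrite eqn_leq -{2}[g]invgK !overlap_le_inv. Qed.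

(** Relate [g] to [x] when [g^-1 x] lies in [A]. If [x] is common to [g] and [h], then [g^-1 * h]
    sends the point [h^-1 x] of [A] to [g^-1 x], again in [A]; so the overlap of [g^-1 * h] is at
    least [c ^+ 2 * size A] on average. *)
Lemma overlap_popular_diff (Y : seq G) (c : R) :
    0 <= c -> (forall g, g \in Y -> c * (size A)%:R <= (overlap g)%:R) ->
  c ^+ 2 / 2 * (size Y)%:R ^+ 2 <=
    (count (fun p => c ^+ 2 / 2 * (size A)%:R <= (overlap (p.1^-1 * p.2)%g)%:R)
       [seq (g, h) | g <- Y, h <- Y])%:R.
Proof.
move=> c0 Yc.
pose r g x := act g^-1%g x \in A.
have h1 : c * (size A)%:R * (size Y)%:R <= \sum_(g <- Y) (count (r g) A)%:R.
  rewrite [leLHS](_ : _ = \sum_(g <- Y) c * (size A)%:R); last first.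
    by rewrite sumr_const_seq.
  rewrite big_seq [leRHS]big_seq; apply: ler_sum => g /Yc.
  by rewrite -overlapV.
have := count_common_ge R r Y A.
set e := \sum_(_ <- _) _ in h1 *; set q := \sum_(_ <- _) \sum_(_ <- _) _ => h2.
have q_le : q <= \sum_(z <- [seq (g, h) | g <- Y, h <- Y]) (overlap (z.1^-1 * z.2)%g)%:R.
  rewrite big_allpairs; apply: ler_sum => g _; apply: ler_sum => h _ /=.
  rewrite ler_nat; apply: (count_inj (f := act h^-1%g)) => //.
    by move=> x y _ _; exact: (can_inj (actK h^-1%g)).
  move=> x _ /andP[gx hx]; split=> //.
  by rewrite -(proj2 actP) mulgK.
have h3 : (c * (size A)%:R * (size Y)%:R) ^+ 2 <= e ^+ 2.
  by rewrite ler_sqr ?nnegrE ?(le_trans _ h1) // !mulr_ge0.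
have h4 : c ^+ 2 * (size A)%:R * (size [seq (g, h) | g <- Y, h <- Y])%:R <= q.
  rewrite size_allpairs natrM -(ler_pM2l A0) (le_trans _ (le_trans h3 h2)) //.
  by rewrite le_eqVlt; apply/orP; left; apply/eqP; ring.
have c1 : 0 <= c ^+ 2 * (size A)%:R by rewrite mulr_ge0 // exprn_ge0.
have ovA (z : G * G) : z \in [seq (g, h) | g <- Y, h <- Y] ->
    (overlap (z.1^-1 * z.2)%g)%:R <= (size A)%:R :> R.
  by move=> _; rewrite ler_nat count_size.
have := popular_count c1 ovA (le_trans h4 q_le).
rewrite size_allpairs natrM [_ * _ / 2]mulrAC => h5.
rewrite -(ler_pM2l A0); apply: le_trans h5.
by rewrite le_eqVlt; apply/orP; left; apply/eqP; ring.
Qed.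

Variables (gen : G -> Prop) (S : seq G).
Hypothesis gen_div : forall g h, gen g -> gen h -> gen (g^-1 * h)%g.

(* The last clause transports density: whatever is dense in [Y] has a left
   translate that is dense in [S]. *)
Definition descendant (c : R) (Y : seq G) : Prop :=
  [/\ uniq Y, forall g, g \in Y -> gen g,
      forall g, g \in Y -> c * (size A)%:R <= (overlap g)%:R &
      forall (V : pred G) d, 0 <= d -> d * (size Y)%:R <= (count V Y)%:R ->
        exists h, c * d * (size S)%:R <= (count (fun s => V (h * s)%g) S)%:R].

(** Among the popular quotients, those with at least [k] representations are kept, for a level [k]
    that carries almost all representations. The hypothesis on [b * (1 + ln (size Y))] makes [b] an
    upper bound for the logarithmic loss. *)
Lemma descendant_step (Y : seq G) (b c c' K : R) :
    (0 < size Y)%N -> 0 < b -> 0 < c <= 1 -> 0 < K ->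
    c' <= b * (c ^+ 2 / 2) * c -> b <= 1 ->
    b * (1 + ln (size Y)%:R) < 1 ->
    descendant c Y ->
  (exists2 D : seq G, (size D)%:R <= K * (size Y)%:R &
     b * (c ^+ 2 / 2) * (size Y)%:R ^+ 2 <=
       \sum_(g <- Y) (count (fun h => (g^-1 * h)%g \in D) Y)%:R) \/
  (exists2 Y', descendant c' Y' &
     b * (c ^+ 2 / 2) * K * (size Y)%:R <= (size Y')%:R).
Proof.
move=> sY b0 /andP[c0 c1] K0 c'le b1 bL [uY genY ovY linkY].
set eta := c ^+ 2 / 2 in c'le *.
have eta0 : 0 < eta by rewrite divr_gt0 // exprn_gt0.
have Y0 : 0 < (size Y)%:R :> R by rewrite ltr0n.
pose YY := [seq (g, h) | g <- Y, h <- Y].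
pose dif (p : G * G) := (p.1^-1 * p.2)%g.
pose rep z := count (fun p => dif p == z) YY.
pose pop z := eta * (size A)%:R <= (overlap z)%:R.
pose Q := [seq z <- undup (map dif YY) | pop z].
have uQ : uniq Q by rewrite filter_uniq ?undup_uniq.
have repQ : eta * (size Y)%:R ^+ 2 <= \sum_(z <- Q) (rep z)%:R.
  apply: le_trans (overlap_popular_diff (ltW c0) ovY) _.
  rewrite -(exchange_count R (fun p z => dif p == z)) natr_count -/YY.
  rewrite big_seq [leRHS]big_seq; apply: ler_sum => p pYY.
  rewrite ler_nat; case: (boolP (_ <= _)) => //= popp.
  rewrite -has_count; apply/hasP; exists (dif p) => //=.
  by rewrite mem_filter mem_undup map_f // andbT.
have rep_le z : z \in Q -> (rep z <= size Y)%N.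
  move=> _; rewrite -(count_predT Y); apply: (count_inj (f := fun p => p.1)).
  - exact: uniq_pairs.
  - move=> [g h] [g' h'] /andP[_ /= /eqP e] /andP[_ /= /eqP e'] /= gg.
    by move: e; rewrite -e' /dif /= gg => /mulgI ->.
  - by move=> [g h]; rewrite mem_pairs => /andP[].
have etaY : 0 < eta * (size Y)%:R ^+ 2 by rewrite mulr_gt0 // exprn_gt0.
have HL : \sum_(i < size Y) (i.+1%:R)^-1 < b^-1.
  rewrite (le_lt_trans (harmonic_le R _)) // -(ltr_pM2l b0) divff //.
  by rewrite gt_eqF.
have [k k0 lev] := exists_popular_level etaY rep_le HL repQ.
pose Y' := [seq z <- Q | (k <= rep z)%N].
have sY' : b * eta * (size Y)%:R ^+ 2 <= k%:R * (size Y')%:R.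
  have := ler_wpM2l (ltW b0) lev.
  by rewrite size_filter !mulrA divff ?gt_eqF // mul1r.
have uY' : uniq Y' by rewrite filter_uniq.
have k0R : 0 < k%:R :> R by rewrite ltr0n.
(* Every element of [Y'] comes from at least [k] pairs, so counts in [Y'] become counts of pairs
   from [Y]. *)
have kV (V : pred G) : k%:R * (count V Y')%:R <=
    \sum_(g <- Y) (count (fun h => V (g^-1 * h)%g) Y)%:R :> R.
  rewrite -(natr_count_allpairs R (fun p => V (dif p))).
  apply: (fiber_count (P := V) (f := dif)) => // z.
  by rewrite mem_filter ler_nat => /andP[].
have sY'2 : k%:R * (size Y')%:R <= (size Y)%:R ^+ 2 :> R.
  rewrite -(count_predT Y') (le_trans (kV _)) //.
  under eq_bigr do rewrite count_predT.
  by rewrite sumr_const_seq expr2.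
(* As [k * size Y'] lies between [b * eta * (size Y) ^+ 2] and [(size Y) ^+ 2], a large [k] makes
   [Y'] a small set of quotients and a small [k] makes it a large set. *)
have [kK|kK] := leP (size Y)%:R (k%:R * K).
  left; exists Y'.
    rewrite -(ler_pM2l k0R) (le_trans sY'2) // expr2 mulrA.
    by rewrite ler_wpM2r.
  apply: le_trans sY' _; apply: le_trans (kV (mem Y')).
  rewrite ler_wpM2l ?ler_nat //.
  by rewrite (eq_in_count (a2 := predT)) ?count_predT // => z zY'; exact: zY'.
right; exists Y'; last first.
  rewrite -(ler_pM2r Y0).
  have h1 := ler_wpM2r (ltW K0) sY'.
  have h2 := ler_wpM2r (ler0n R (size Y')) (ltW kK).
  by move: h1 h2; lra.
have be0 : 0 < b * eta by rewrite mulr_gt0.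
have c'c : c' <= c.
  rewrite (le_trans c'le) // ler_piMl ?(ltW c0) // mulr_ile1 ?(ltW b0) ?(ltW eta0) //.
  by rewrite /eta; have := exprn_ile1 2 (ltW c0) c1; lra.
have c'eta : c' <= eta.
  have bc : b * c <= 1 by rewrite mulr_ile1 ?(ltW b0) ?(ltW c0).
  by have := ler_wpM2r (ltW eta0) bc; move: c'le; lra.
split=> //.
- move=> z; rewrite !mem_filter mem_undup => /and3P[_ _ /mapP[[g h]]].
  by rewrite mem_pairs => /andP[gY hY] ->; apply: gen_div; exact: genY.
- move=> z; rewrite !mem_filter => /and3P[_ popz _].
  by rewrite (le_trans _ popz) // ler_wpM2r.
(* By [kV], many pairs have their quotient in [V]. Averaging fixes a [g] for which the [h] with
   [g^-1 * h] in [V] are dense in [Y], and the transport from [Y] to [S] applies to these [h]. *)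
- move=> V d d0 dV.
  have h1 : d * (b * eta) * (size Y)%:R * (size Y)%:R <=
      \sum_(g <- Y) (count (fun h => V (g^-1 * h)%g) Y)%:R.
    apply: le_trans (kV V); apply: le_trans (ler_wpM2l (ltW k0R) dV).
    have := ler_wpM2l d0 sY'; rewrite (mulrCA _ d) => h.
    by rewrite (le_trans _ h) // le_eqVlt; apply/orP; left; apply/eqP; ring.
  have [g gY /linkY[]] := exists_ge_average sY h1.
    by rewrite mulr_ge0 // ltW.
  move=> h hS; exists (g^-1 * h)%g.
  under eq_count do rewrite -mulgA.
  apply: le_trans hS; rewrite ler_wpM2r //.
  by have := ler_wpM2r d0 c'le; lra.
Qed.

End ActionStep.

(** * The iteration and its termination *)

(* One step of the iteration turns popularity [b ^+ e] into [b ^+ (3 * e + 2)]. *)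
Fixpoint level (j : nat) : nat := if j is i.+1 then 3 * level i + 2 else 2.

Lemma leq_level (i j : nat) : (i <= j)%N -> (level i <= level j)%N.
Proof.
move=> /subnKC <-; elim: (j - i)%N => [|k IH]; first by rewrite addn0.
by rewrite addnS (leq_trans IH) //= (leq_trans _ (leq_addr _ _)) // leq_pmull.
Qed.

(** As [K] is the inverse of [(b ^+ m) ^+ 2], a step that loses [b ^+ m] and gains [K] enlarges the
    set by the inverse of [b ^+ m]; after [J] such steps it would exceed [M]. The value of [m] makes
    [b ^+ m] at most [b * (c ^+ 2 / 2)] at every step. *)
Lemma exists_closed_descendant (R : realType) (G : groupType) (X : choiceType)
    (act : G -> X -> X) (A : seq X) (gen : G -> Prop) (S Y0 : seq G)
    (b K M : R) (J m : nat) :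
    is_left_action act -> uniq A -> (0 < size A)%N ->
    (forall g h, gen g -> gen h -> gen (g^-1 * h)%g) ->
    0 < b <= 2^-1 -> m = (2 * level J + 2)%N -> K * (b ^+ m) ^+ 2 = 1 ->
    (forall Y e, (e <= m)%N -> descendant act A gen S (b ^+ e) Y ->
      (size Y)%:R <= M) ->
    b * (1 + ln M) < 1 -> (b ^+ m) ^+ J * M < 1 ->
    (0 < size Y0)%N -> descendant act A gen S (b ^+ 2) Y0 ->
  exists e Y D, [/\ (e <= m)%N, (0 < size Y)%N,
    descendant act A gen S (b ^+ e) Y, (size D)%:R <= K * (size Y)%:R &
    b ^+ m * (size Y)%:R ^+ 2 <=
       \sum_(g <- Y) (count (fun h => (g^-1 * h)%g \in D) Y)%:R].
Proof.
move=> actP uA sA gen_div /andP[b0 b2] mE Kb boundY bM JM sY0 descY0.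
have bm0 : 0 < b ^+ m by rewrite exprn_gt0.
have b1 : b <= 1 by lra.
have K0 : 0 < K by rewrite -(pmulr_lgt0 _ (exprn_gt0 2 bm0)) Kb.
case: (pselect (exists e Y D, [/\ (e <= m)%N, (0 < size Y)%N,
    descendant act A gen S (b ^+ e) Y, (size D)%:R <= K * (size Y)%:R &
    b ^+ m * (size Y)%:R ^+ 2 <=
       \sum_(g <- Y) (count (fun h => (g^-1 * h)%g \in D) Y)%:R])) => // none.
have chain j : (j <= J)%N -> exists Y, [/\ (0 < size Y)%N,
    descendant act A gen S (b ^+ level j) Y & 1 <= (b ^+ m) ^+ j * (size Y)%:R].
  elim: j => [_|j IH jJ]; first by exists Y0; rewrite expr0 mul1r ler1n.
  have [Y [sY dY growY]] := IH (ltnW jJ).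
  have lm : (2 * level j + 2 <= m)%N.
    by rewrite mE leq_add2r leq_mul2l /= leq_level // ltnW.
  have lm' : (level j <= m)%N.
    by rewrite (leq_trans _ lm) // (leq_trans _ (leq_addr _ _)) // leq_pmull.
  set c := b ^+ level j in dY.
  have c0 : 0 < c by rewrite exprn_gt0.
  have c1 : c <= 1 by rewrite exprn_ile1 // ltW.
  (* The spare factor [b <= 1/2] pays for the halving in [c ^+ 2 / 2]. *)
  have c'le : b ^+ level j.+1 <= b * (c ^+ 2 / 2) * c.
    rewrite (_ : b ^+ level j.+1 = b * c ^+ 3 * b); last first.
      by rewrite /= exprD mulnC exprM /c; ring.
    have := ler_wpM2l (mulr_ge0 (ltW b0) (exprn_ge0 3 (ltW c0))) b2; lra.
  have bmc : b ^+ m <= b * (c ^+ 2 / 2).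
    apply: (@le_trans _ _ (b ^+ (2 * level j + 2))).
      by rewrite ler_wiXn2l // ltW.
    rewrite exprD mulnC exprM -/c.
    have := ler_wpM2l (mulr_ge0 (ltW b0) (exprn_ge0 2 (ltW c0))) b2; lra.
  have bY : b * (1 + ln (size Y)%:R) < 1.
    apply: le_lt_trans bM; rewrite ler_wpM2l ?(ltW b0) // lerD2l.
    have YM := boundY _ _ lm' dY.
    rewrite ler_ln ?posrE ?ltr0n // (lt_le_trans _ YM) // ltr0n //.
  have cc : 0 < c <= 1 by rewrite c0 c1.
  have [[D DK Dd]|[Y' dY' growY']] :=
      descendant_step actP uA sA gen_div sY b0 cc K0 c'le b1 bY dY.
    case: none; exists (level j), Y, D; split=> //.
    by rewrite (le_trans _ Dd) // ler_wpM2r // exprn_ge0.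
  have h : 1 <= (b ^+ m) ^+ j.+1 * (size Y')%:R.
    apply: (le_trans growY); rewrite exprSr -mulrA ler_wpM2l //.
      by rewrite exprn_ge0 // ltW.
    have h1 := ler_wpM2r (mulr_ge0 (ltW K0) (ler0n R (size Y))) bmc.
    have := ler_wpM2l (ltW bm0) (le_trans h1 (le_trans _ growY')).
    rewrite -mulrA => /(_ (lexx _)) h2; apply: le_trans h2.
    by rewrite mulrA -expr2 mulrA [_ * K]mulrC Kb mul1r.
  exists Y'; split=> //; rewrite lt0n; apply/eqP => Y'0; move: h.
  by rewrite Y'0 mulr0 ler10.
have [Y [sY dY growY]] := chain J (leqnn J).
have lm : (level J <= m)%N.
  by rewrite mE (leq_trans _ (leq_addr _ _)) // leq_pmull.
have YM := boundY _ _ lm dY.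
have := ler_wpM2l (exprn_ge0 J (ltW bm0)) YM.
by move=> /(le_trans growY) /le_lt_trans /(_ JM); rewrite ltxx.
Qed.

(** * Bounding sets of popular elements by stabilisers *)

Lemma card_count (T : finType) (P : pred T) : #|P| = count P (enum {: T}).
Proof. by rewrite cardE enumT -size_filter. Qed.

(** Count the triples [(g, a, b)] where [g] in [Y] sends the tuple [a], not bad, to [b]. Each [g]
    maps at least the [n]-th power of [c * #|A|] tuples into [A], and at most [#|bad|] of them are
    discarded. For fixed [a] and [b], such [g] differ by elements fixing [a], so there are at most
    [s] of them. *)
Lemma size_le_of_small_stab (R : realType) (G : groupType) (X : choiceType)
    (act : G -> X -> X) (A : {fset X}) (gen : G -> Prop) (n : nat)
    (bad : pred (n.-tuple A)) (s c : R) (Y : seq G) :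
    is_left_action act ->
    (forall g h, gen g -> gen h -> gen (g^-1 * h)%g) ->
    0 <= s -> 0 <= c ->
    (forall a Q, ~~ bad a -> uniq Q ->
      (forall g, g \in Q -> gen g /\ {in [seq val x | x <- a], forall x, act g x = x}) ->
      (size Q)%:R <= s) ->
    uniq Y -> (forall g, g \in Y -> gen g) ->
    (forall g, g \in Y -> c * #|` A|%:R <= (overlap act A g)%:R) ->
  ((c * #|` A|%:R) ^+ n - #|bad|%:R) * (size Y)%:R <= (#|` A|%:R ^+ n) ^+ 2 * s.
Proof.
move=> actP gen_div s0 c0 stab uY genY ovY.
pose img g (a b : n.-tuple A) := [seq act g (val x) | x <- a] == [seq val x | x <- b].
pose V := enum {: n.-tuple A}.
have sV : (size V)%:R = #|` A|%:R ^+ n :> R.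
  by rewrite -cardE card_tuple -cardfE natrX.
apply: (@le_trans _ _ (\sum_(g <- Y) \sum_(a <- V) \sum_(b <- V)
    (~~ bad a && img g a b)%:R)).
  rewrite [leLHS](_ : _ = \sum_(g <- Y) ((c * #|` A|%:R) ^+ n - #|bad|%:R)); last first.
    by rewrite sumr_const_seq.
  rewrite big_seq [leRHS]big_seq; apply: ler_sum => g gY.
  pose Ag := [pred x : A | act g (val x) \in A].
  pose fits (a : n.-tuple A) := all Ag a.
  have ovAg : (overlap act A g <= #|Ag|)%N.
    by rewrite /overlap [X in count _ X]enum_fsetE count_map card_count.
  have fitsV : (#|Ag| ^ n <= count fits V)%N.
    rewrite -[n in (_ ^ n)%N]card_ord -card_ffun_on cardE -(count_predT (enum _)).
    apply: (count_inj (f := fun h : {ffun 'I_n -> A} => [tuple h i | i < n])).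
    - exact: enum_uniq.
    - move=> h h' _ _ hh; apply/ffunP => i.
      by have := congr1 (fun t => tnth t i) hh; rewrite !tnth_mktuple.
    - move=> h; rewrite mem_enum => /ffun_onP hAg _; rewrite mem_enum; split=> //.
      by apply/allP => _ /mapP[i _ ->]; exact: hAg.
  apply: (@le_trans _ _ (count (fun a => ~~ bad a && fits a) V)%:R).
    rewrite lerBlDr; apply: (@le_trans _ _ (count fits V)%:R).
      apply: (@le_trans _ _ ((overlap act A g)%:R ^+ n)).
        by rewrite lerXn2r ?nnegrE ?mulr_ge0 // ovY.
      rewrite -natrX ler_nat (leq_trans _ fitsV) //.
      by case: (n) => // k; rewrite leq_exp2r.
    rewrite card_count -natrD ler_nat -count_predUI (leq_trans _ (leq_addr _ _)) //.
    by apply: sub_count => a /= ->; rewrite andbT orNb.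
  rewrite natr_count; apply: ler_sum => a _.
  case: (boolP (_ && _)) => [/andP[ga fa]|_]; last by apply: sumr_ge0.
  rewrite ga /= -natr_count ler1n -has_count; apply/hasP.
  (* Since [a] fits, all images lie in [A] and [insubd] never returns its default. *)
  exists [tuple of [seq insubd x (act g (val x)) | x <- a]]; first by rewrite mem_enum.
  rewrite /img -map_comp; apply/eqP/eq_in_map => x /(allP fa) /= gx.
  by rewrite insubdK.
rewrite exchange_big /=; under eq_bigr do rewrite exchange_big /=.
rewrite expr2 -sV -mulrA.
have -> : (size V)%:R * ((size V)%:R * s) = \sum_(a <- V) \sum_(b <- V) s.
  under eq_bigr do rewrite sumr_const_seq.
  by rewrite sumr_const_seq mulrC [s * _]mulrC.
apply: ler_sum => a _; apply: ler_sum => b _.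
case: (boolP (bad a)) => ba /=; first by rewrite big1_eq.
rewrite -natr_count -size_filter.
case: (posnP (size [seq g <- Y | img g a b])) => [->//|].
case: {-1}[seq g <- Y | img g a b] (erefl [seq g <- Y | img g a b]) => // g0 Q0 QE _.
(* Left translation by the inverse of one solution [g0] moves all solutions into the stabiliser of
   [a]. *)
rewrite -(size_map (fun g => (g0^-1 * g)%g)).
have g0Q : g0 \in [seq g <- Y | img g a b] by rewrite QE mem_head.
move: g0Q; rewrite mem_filter => /andP[/eqP g0ab g0Y].
apply: (stab a) => //.
  by rewrite map_inj_in_uniq -?QE ?filter_uniq // => ? ? _ _ /mulgI.
move=> _ /mapP[g + ->]; rewrite -QE mem_filter => /andP[/eqP gab gY].
split; first by apply: gen_div; exact: genY.
move=> _ /mapP[x xa ->]; rewrite (proj2 actP).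
have /eq_in_map -> // : [seq act g (val x) | x <- a] = [seq act g0 (val x) | x <- a].
  by rewrite gab g0ab.
exact: (actK actP).
Qed.

(** * Points with few images under an approximate subgroup *)

Lemma approx_subgroup_le (R : realType) (G : groupType) (k l : R) (H : {fset G}) :
  k <= l -> approx_subgroup k H -> approx_subgroup l H.
Proof.
move=> kl [H1 HV [Z [Zk sub]]]; split=> //; exists Z; split=> //.
exact: le_trans kl.
Qed.

(** [T] consists of the points that at least [c / 2 * size V] elements of [V] send into [A]. For [h]
    in [H] and [y] in [T], each such [g] recovers [h y] from [x^-1 * g * h^-1], in [H H], and [g y],
    in [A]. So every image has many representations in [H H] times [A], and [H H] has at most
    [k * #|H|] elements. *)
Lemma exists_small_orbit_part (R : realType) (G : groupType) (X : choiceType)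
    (act : G -> X -> X) (A : {fset X}) (H : {fset G}) (x : G) (V : seq G)
    (k q c : R) :
    is_left_action act -> approx_subgroup k H -> 0 <= k -> 0 < c ->
    uniq V -> (0 < size V)%N ->
    (forall g, g \in V -> (x^-1 * g)%g \in H) ->
    (forall g, g \in V -> c * #|` A|%:R <= (overlap act A g)%:R) ->
    #|` H|%:R <= q * (size V)%:R ->
  exists T : {fset X}, [/\ T `<=` A, c / 2 * #|` A|%:R <= #|` T|%:R &
    c / 2 * #|` [fset act h x | h in H, x in T]|%:R <= k * q * #|` A|%:R].
Proof.
move=> actP appH k0 c0 uV sV VH ovV HV.
have V0 : 0 < (size V)%:R :> R by rewrite ltr0n.
pose hit y := count (fun g => act g y \in A) V.
pose P y := c / 2 * (size V)%:R <= (hit y)%:R.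
pose T := [fset y in A | P y].
have sumhit : c * (size V)%:R * #|` A|%:R <= \sum_(y <- A) (hit y)%:R.
  rewrite /hit -(exchange_count R (fun g y => act g y \in A)).
  rewrite mulrAC -sumr_const_seq big_seq [leRHS]big_seq; apply: ler_sum => g gV.
  exact: ovV.
have hitV y : y \in enum_fset A -> (hit y)%:R <= (size V)%:R :> R.
  by move=> _; rewrite ler_nat count_size.
have cV : 0 <= c * (size V)%:R by rewrite mulr_ge0 // ltW.
have := popular_count cV hitV sumhit; rewrite [_ * _ / 2]mulrAC => popA.
exists T; split.
- exact: fset_sub.
- have countT : (count P A <= #|` T|)%N.
    rewrite -size_filter uniq_leq_size ?filter_uniq ?fset_uniq // => y.
    by rewrite mem_filter !inE andbC.
  rewrite -(ler_pM2l V0); apply: (@le_trans _ _ ((size V)%:R * (count P A)%:R)).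
    by rewrite (le_trans _ popA) // le_eqVlt; apply/orP; left; apply/eqP; ring.
  by rewrite ler_wpM2l // ler_nat.
have [_ Hinv [Z [Zk HHZ]]] := appH.
set HT := [fset _ | _ in _, _ in _].
pose HH := [fset (x * y)%g | x in H, y in H].
have cHH : #|` HH|%:R <= k * #|` H|%:R :> R.
  apply: (@le_trans _ _ (#|` Z|%:R * #|` H|%:R)); last by rewrite ler_wpM2r.
  rewrite -natrM ler_nat -(size_allpairs (fun z h => (z * h)%g)) uniq_leq_size ?fset_uniq //.
  move=> y /(fsubsetP HHZ) /imfset2P[z /= zZ [h /= hH ->]].
  by apply/allpairsP; exists (z, h).
pose f (p : G * X) := act (p.1^-1 * x^-1)%g p.2.
have fib y : y \in enum_fset HT -> true -> c / 2 * (size V)%:R <=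
    (count (fun p => f p == y) [seq (h, z) | h <- HH, z <- A])%:R.
  move=> /imfset2P[h0 /= h0H [y0 /= + ->]] _.
  rewrite !inE => /andP[y0A /le_trans]; apply; rewrite ler_nat.
  apply: (count_inj (f := fun g => ((x^-1 * g * h0^-1)%g, act g y0))) => //.
    by move=> g g' _ _ [/mulIg /mulgI].
  move=> g gV gy; rewrite mem_pairs gy andbT; split.
    apply: in_imfset2; rewrite ?VH //= Hinv.
    by apply/imfsetP; exists h0.
  by rewrite /f /= -!(proj2 actP) !invgM !invgK !mulgA mulgK mulgVK.
have := fiber_count (fset_uniq HT) fib.
rewrite !count_predT size_allpairs natrM => cHT.
rewrite -(ler_pM2l V0); apply: le_trans (_ : #|` HH|%:R * #|` A|%:R <= _).
  by rewrite (le_trans _ cHT) // le_eqVlt; apply/orP; left; apply/eqP; ring.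
rewrite mulrA ler_wpM2r // (le_trans cHH) //.
by have := ler_wpM2l k0 HV; lra.
Qed.

(** * Generated subgroups and the counting measure *)

Lemma generated_subgroup_div (G : groupType) (S : set G) (g h : G) :
  generated_subgroup S g -> generated_subgroup S h ->
  generated_subgroup S (g^-1 * h)%g.
Proof.
move=> gS hS K KS; have [Kc _] := KS.
have /mem_set gK := gS _ KS; have /mem_set hK := hS _ KS.
apply/set_mem; apply: (group_closedM Kc) => //; exact: (group_closedV Kc).
Qed.

(** The negated inequality forces [P] to be finite, since its counting measure would otherwise be
    infinite. *)
Lemma size_le_counting (R : realType) (T : choiceType) (P : set T) (s : R)
    (Q : seq T) :
    ~ (s%:E <= counting P)%E -> uniq Q -> (forall x, x \in Q -> P x) ->
  (size Q)%:R <= s.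
Proof.
rewrite /counting; case: asboolP => [finP|_]; last by rewrite leey.
rewrite lee_fin => /negP; rewrite -ltNge => /ltW cP uQ QP; apply: le_trans cP.
rewrite ler_nat; apply: uniq_leq_size => // x /QP Px.
by rewrite in_fset_set // inE.
Qed.

(** * Bounds as powers of the size of [A] *)

(* The power [tau] must be fixed before [eps]: [a `^ eps] need not be large. *)
Lemma exists_threshold (R : realType) (r tau C : R) :
    0 < r -> 0 < tau -> 0 <= C ->
  exists2 eps : R, 0 < eps <= tau & forall a, 0 <= a -> eps^-1 < a `^ r^-1 ->
    [/\ 1 <= a, 2 <= a `^ tau & 1 + C * ln a < a `^ tau].
Proof.
move=> r0 tau0 C0.
(* With [u = a ^ (tau / 2)], sublinearity gives [ln a <= 2 / tau * u], so [D <= u] yields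
   [1 + C * ln a < D * u <= u ^ 2 = a ^ tau]. The value of [eps] below is what forces [D <= u]. *)
pose D := 2 + C * (2 / tau).
have D2 : 2 <= D by rewrite lerDl mulr_ge0 // divr_ge0 // ltW.
have D0 : 0 < D by lra.
have rt0 : 0 < r * (tau / 2) by rewrite mulr_gt0 // divr_gt0.
pose eps := Num.min tau (D `^ (- (r * (tau / 2))^-1)).
have eps0 : 0 < eps by rewrite lt_min tau0 powR_gt0.
exists eps; first by rewrite eps0 ge_min lexx.
move=> a a0 epsa.
have u0 : D <= a `^ (tau / 2).
  have -> : a `^ (tau / 2) = (a `^ r^-1) `^ (r * (tau / 2)).
    by rewrite -powRrM mulrA mulVf ?mul1r // gt_eqF.
  have -> : D = (D `^ (r * (tau / 2))^-1) `^ (r * (tau / 2)).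
    by rewrite -powRrM mulVf ?powRr1 // ?ltW // gt_eqF.
  rewrite ge0_ler_powR ?(ltW rt0) ?nnegrE ?powR_ge0 // (le_trans _ (ltW epsa)) //.
  rewrite -[leLHS]invrK -powRN lef_pV2 ?posrE ?powR_gt0 //.
  by rewrite ge_min lexx orbT.
have a_gt0 : 0 < a.
  apply: (@gt0_powR _ a r^-1) => //; rewrite ?invr_gt0 //.
  by apply: lt_trans epsa; rewrite invr_gt0.
have a1 : 1 <= a.
  rewrite leNgt; apply/negP => a1.
  have : a `^ (tau / 2) <= a `^ 0.
    by apply: ger_powR; rewrite ?a_gt0 ?(ltW a1) // divr_ge0 // ltW.
  by rewrite powRr0 => /(le_trans u0); lra.
have u2 : a `^ tau = a `^ (tau / 2) * a `^ (tau / 2).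
  by rewrite -powRD ?gt_eqF ?implybT // -splitr.
have lna : ln a <= 2 / tau * a `^ (tau / 2).
  have h1 := ltW (ln_sublinear (powR_gt0 (tau / 2) a_gt0)).
  have t0 : 0 <= 2 / tau by rewrite divr_ge0 // ltW.
  apply: le_trans (ler_wpM2l t0 h1); rewrite ln_powR mulrA.
  by rewrite (_ : 2 / tau * (tau / 2) = 1) ?mul1r //; field; rewrite gt_eqF.
set u := a `^ (tau / 2) in u0 u2 lna.
rewrite u2; split=> //.
  have := ler_pM (_ : 0 <= 2) (_ : 0 <= 1) (le_trans D2 u0) (_ : 1 <= u).
  by rewrite mulr1; apply => //; lra.
have h1 := ler_wpM2l C0 lna.
have u_gt0 : 0 < u by lra.
have h2 := ler_wpM2r (ltW u_gt0) u0.
rewrite (lt_le_trans _ h2) // /D; lra.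
Qed.

(** Passing to [V], the part of [Y] in [x H], gives [#|H| <= K ^+ 116 * size V], where
    [116 = 90 + 26]. As [c / 2] is at least [K^-1], pulling the density of [V] back to [S] costs
    [27 = 26 + 1] powers of [K], and the orbit bound costs [365 = 248 + 116 + 1]. *)
Lemma approx_subgroup_of_closed_descendant (R : realType) (G : groupType)
    (X : choiceType) (act : G -> X -> X) (A : {fset X}) (gen : G -> Prop)
    (S : {fset G}) (Y D : seq G) (c K : R) :
    is_left_action act -> 2 <= K -> 0 < c <= 1 -> K^-1 <= c / 2 -> (0 < size Y)%N ->
    descendant act A gen S c Y -> (size D)%:R <= K * (size Y)%:R ->
    (size Y)%:R ^+ 2 <=
      K * \sum_(g <- Y) (count (fun h => (g^-1 * h)%g \in D) Y)%:R ->
  exists (H : {fset G}) (T : {fset X}),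
    [/\ approx_subgroup (K ^+ 248) H /\ #|` H|%:R <= K ^+ 90 * (size Y)%:R,
        T `<=` A,
        exists h : G,
          (K ^+ 27)^-1 * #|` S|%:R <= #|` H `&` [fset (h * s)%g | s in S]|%:R,
        K^-1 * #|` A|%:R <= #|` T|%:R &
        #|` [fset act h x | h in H, x in T]|%:R <= K ^+ 365 * #|` A|%:R].
Proof.
move=> actP K2 /andP[c0 c1] Kc sY [uY genY ovY linkY] DK YD.
have K0 : 0 < K by lra.
have [H [x [appH cH cV]]] := approx_subgroup_of_popular_diff K2 uY sY DK YD.
pose V := [seq y <- Y | (x^-1 * y)%g \in H].
have sV : (0 < size V)%N.
  rewrite lt0n size_filter; apply/eqP => V0; move: cV.
  by rewrite V0 mulr0 leNgt ltr0n sY.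
have HV : #|` H|%:R <= K ^+ 116 * (size V)%:R.
  apply: le_trans cH _; rewrite (_ : 116 = 90 + 26)%N // exprD -mulrA.
  by rewrite ler_wpM2l ?size_filter // exprn_ge0 // ltW.
have uV : uniq V by rewrite filter_uniq.
have VH g : g \in V -> (x^-1 * g)%g \in H by rewrite mem_filter => /andP[].
have ovV g : g \in V -> c * #|` A|%:R <= (overlap act A g)%:R.
  by rewrite mem_filter => /andP[_ /ovY].
have [T [TA cT cHT]] := exists_small_orbit_part actP appH (exprn_ge0 _ (ltW K0))
  c0 uV sV VH ovV HV.
exists H, T; split=> //.
- have d0 : 0 <= (K ^+ 26)^-1 by rewrite invr_ge0 exprn_ge0 // ltW.
  have dY : (K ^+ 26)^-1 * (size Y)%:R <= (count (fun y => (x^-1 * y)%g \in H) Y)%:R.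
    by rewrite ler_pdivrMl // exprn_gt0.
  have [h hS] := linkY _ _ d0 dY.
  exists (x^-1 * h)%g.
  apply: (@le_trans _ _ (c * (K ^+ 26)^-1 * #|` S|%:R)).
    rewrite ler_wpM2r // exprS invfM ler_wpM2r // (le_trans Kc) //; lra.
  apply: le_trans hS _; rewrite ler_nat -size_filter.
  rewrite -(size_map (fun s => (x^-1 * h * s)%g)); apply: uniq_leq_size.
    by rewrite map_inj_in_uniq ?filter_uniq ?fset_uniq // => ? ? _ _ /mulgI.
  move=> _ /mapP[s + ->]; rewrite mem_filter => /andP[hsH sS].
  by rewrite in_fsetI in_imfset // -mulgA hsH.
- by apply: le_trans cT; rewrite ler_wpM2r.
- have h1 := ler_wpM2r (ler0n R #|` [fset act h x0 | h in H, x0 in T]|) Kc.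
  have := ler_wpM2l (ltW K0) (le_trans h1 cHT).
  rewrite mulrA divff ?gt_eqF // mul1r => /le_trans; apply.
  by rewrite mulrA -exprD -exprS.
Qed.

(* [tau] is the exponent of the loss in one step, [gam] that of the gain, and
   [J] the number of steps; [365] is the worst exponent in the conclusion. *)
Lemma exists_exponents (R : realType) (n : nat) (t delta : R) :
    0 < t -> 0 < delta ->
  exists (gam tau : R) (J : nat),
    [/\ 0 < gam, 0 < tau <= gam / 2,
        tau * (2 * level J + 2)%:R = gam / 2,
        (365 + n%:R) * gam <= Num.min delta 1 &
        n%:R + t + 2 <= gam / 2 * J%:R].
Proof.
move=> t0 delta0; set dl := Num.min delta 1.
have dl0 : 0 < dl by rewrite lt_min delta0 ltr01.
have [N NE] : exists N : R, N = 365 + n%:R by exists (365 + n%:R).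
have N0 : 0 < N by rewrite NE; have := ler0n R n; lra.
have gam0 : 0 < dl / N by rewrite divr_gt0.
have gamN : N * (dl / N) = dl by rewrite mulrC divfK // gt_eqF.
rewrite -NE; move: (dl / N) gam0 gamN => gam gam0 gamN {N0 NE}.
(* [J] depends on [gam] alone; [tau] is chosen after it, since the accumulated loss
   [2 * level J + 2] depends on [J]. *)
pose J := (Num.truncn ((n%:R + t + 2) / (gam / 2))).+1.
have m0 : (0 : R) < (2 * level J + 2)%:R by rewrite ltr0n addn2.
have m1 : (1 : R) <= (2 * level J + 2)%:R by rewrite ler1n addn2.
exists gam, (gam / 2 / (2 * level J + 2)%:R), J; split=> //.
- by rewrite !divr_gt0 // ler_pdivrMr // ler_peMr // ltW // divr_gt0.
- by rewrite divfK // gt_eqF.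
- by rewrite gamN.
- by rewrite mulrC -ler_pdivrMr ?divr_gt0 // ltW // truncnS_gt.
Qed.

(** The condition [n * x + tau <= delta] and [2 <= a ^ tau] make the bad tuples at most half of the
    [a ^ (n - n * x)] tuples that each element maps into [A]. The resulting factor 2 is absorbed
    into the final [a ^ tau]. *)
Lemma size_le_of_small_stab_powR (R : realType) (G : groupType)
    (X : choiceType) (act : G -> X -> X) (A : {fset X}) (K : set G) (n : nat)
    (x t tau delta : R) (Y : seq G) (a : R) :
    is_left_action act ->
    (forall g h, K g -> K h -> K (g^-1 * h)%g) ->
    a = #|` A|%:R -> 1 <= a -> 2 <= a `^ tau -> n%:R * x + tau <= delta ->
    #|[pred z : n.-tuple A | `[< ((a `^ t)%:E
       <= counting (pointwise_stab act K [seq val y | y <- z]))%E >] ]|%:R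
      <= a `^ (n%:R - delta) ->
    uniq Y -> (forall g, g \in Y -> K g) ->
    (forall g, g \in Y -> a `^ (- x) * a <= (overlap act A g)%:R) ->
  (size Y)%:R <= a `^ (n%:R + t + n%:R * x + tau).
Proof.
move=> actP K_div aE a1 tau2 xdelta; set bad := [pred _ | _] => stabA uY KY ovY.
have a0 : 0 < a := lt_le_trans ltr01 a1.
have aD u v : a `^ (u + v) = a `^ u * a `^ v.
  by rewrite powRD // (gt_eqF a0) implybT.
have stab z Q : ~~ bad z -> uniq Q ->
    (forall g, g \in Q -> K g /\
      {in [seq val y | y <- z], forall y, act g y = y}) -> (size Q)%:R <= a `^ t.
  by move=> /asboolP nz uQ QP; apply: size_le_counting nz uQ _ => g /QP.
rewrite aE in ovY; have := size_le_of_small_stab actP K_div (powR_ge0 a t)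
  (powR_ge0 _ (- x)) stab uY KY ovY.
rewrite -aE => cardY.
have e1 : (a `^ (- x) * a) ^+ n = a `^ (n%:R - n%:R * x).
  rewrite -[X in _ * X]powRr1 ?(ltW a0) // -aD -powR_mulrn ?powR_ge0 // -powRrM.
  by congr powR; ring.
have e2 : (a ^+ n) ^+ 2 * a `^ t =
    a `^ (n%:R - n%:R * x) * a `^ (n%:R + t + n%:R * x).
  by rewrite -aD -exprM -powR_mulrn ?(ltW a0) // -aD natrM; congr powR; ring.
have half : 2 * a `^ (n%:R - delta) <= a `^ (n%:R - n%:R * x).
  apply: le_trans (ler_wpM2r (powR_ge0 _ _) tau2) _.
  by rewrite -aD ler_powR //; lra.
rewrite e1 e2 in cardY.
move: cardY half stabA (powR_gt0 (n%:R - n%:R * x) a0)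
  (powR_ge0 a (n%:R + t + n%:R * x)) tau2.
rewrite [n%:R + t + _ + tau]addrC (aD tau).
move: (a `^ (n%:R - delta)) (a `^ (n%:R - n%:R * x)) 
  (a `^ (n%:R + t + n%:R * x)) => d p q.
move: (a `^ tau) #|bad|%:R (size Y)%:R (ler0n R (size Y)) =>
  u w y y0 cardY half stabA p0 q0 u2.
have h1 : p * y <= p * (2 * q).
  have hw : p / 2 <= p - w by lra.
  by have := ler_wpM2r y0 hw; move: cardY; lra.
rewrite ler_pM2l // in h1.
by have := ler_wpM2r q0 u2; lra.
Qed.

(** * Start of the iteration and assembly *)

(** The elements of [S] with at least half the guaranteed average overlap form the first set. As
    [b <= 1/2], both its popularity [b / 2] and its density [b / 2] in [S] are at least [b ^+ 2]. *)
Lemma descendant_init (R : realType) (G : groupType) (X : choiceType)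
    (act : G -> X -> X) (A : {fset X}) (S : {fset G}) (gen : G -> Prop) (b : R) :
    0 < b <= 2^-1 -> (0 < #|` A|)%N -> (0 < #|` S|)%N ->
    (forall g, g \in S -> gen g) ->
    b * #|` A|%:R * #|` S|%:R <=
      #|` [fset p in S `*` A `*` A | act p.1.1 p.1.2 == p.2]|%:R ->
  exists2 Y : seq G, (0 < size Y)%N & descendant act A gen S (b ^+ 2) Y.
Proof.
move=> /andP[b0 b2] A0 S0 genS; set E := [fset _ in _ | _] => cardE.
have bA0 : 0 < b * #|` A|%:R by rewrite mulr_gt0 // ltr0n.
have sumS : b * #|` A|%:R * #|` S|%:R <= \sum_(s <- S) (overlap act A s)%:R.
  apply: le_trans cardE _.
  rewrite -(natr_count_allpairs R (fun p => act p.1 p.2 \in A)) ler_nat.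
  rewrite -(count_predT (enum_fset E)).
  apply: (count_inj (f := fun p => p.1)); first exact: fset_uniq.
    move=> [[s x] y] [[s' x'] y']; rewrite !inE /= => /andP[/andP[_ /eqP <-] _].
    by move=> /andP[/andP[_ /eqP <-] _] [-> ->].
  move=> [[s x] y]; rewrite !inE /= mem_pairs => /andP[/andP[/andP[-> ->] yA]] /eqP gxy _.
  by rewrite gxy.
have ovS s : s \in enum_fset S -> (overlap act A s)%:R <= #|` A|%:R :> R.
  by rewrite ler_nat count_size.
pose Y := [seq s <- enum_fset S | b * #|` A|%:R / 2 <= (overlap act A s)%:R].
have := popular_count (ltW bA0) ovS sumS; rewrite -size_filter -/Y => h.
have sizeY : b ^+ 2 * #|` S|%:R <= (size Y)%:R.
  rewrite -(@ler_pM2l _ #|` A|%:R) ?ltr0n // (le_trans _ h) //.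
  have := ler_wpM2r (mulr_ge0 (ltW bA0) (ler0n R #|` S|)) b2.
  by clear; lra.
exists Y.
  by rewrite -(ltr0n R) (lt_le_trans _ sizeY) // mulr_gt0 ?exprn_gt0 ?ltr0n.
split.
- by rewrite filter_uniq ?fset_uniq.
- by move=> g; rewrite mem_filter => /andP[_ /genS].
- move=> g; rewrite mem_filter => /andP[ovg _]; apply: le_trans ovg.
  by rewrite expr2 -mulrA [leRHS]mulrC ler_wpM2r // ltW.
- move=> V d d0 dV; exists 1%g; under eq_count do rewrite mul1g.
  apply: (@le_trans _ _ (count V Y)%:R).
    by apply: le_trans dV; rewrite mulrAC mulrC ler_wpM2l.
  by rewrite ler_nat count_filter; apply: sub_count => s /andP[].
Qed.

Theorem corollaryB5 (R : realType) (n : nat) (r t delta : R)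
    (n_gt0 : (0 < n)%N) (r_gt0 : 0 < r) (t_gt0 : 0 < t)
    (delta_gt0 : 0 < delta) :
  exists2 eps : R, 0 < eps &
  forall (G : groupType) (X : choiceType) (act : G -> X -> X),
    is_left_action act ->
  forall (S : {fset G}) (A : {fset X}),
    [/\ eps^-1 < #|` A|%:R `^ r^-1,
        #|` A|%:R `^ r^-1 <= #|` S|%:R &
        #|` S|%:R <= #|` A|%:R `^ r] ->
    #|[pred a : n.-tuple A |
        `[< ((#|` A|%:R `^ t)%:E
             <= counting (pointwise_stab act (generated_subgroup [set` S])
                          [seq val x | x <- a]))%E >] ]|%:R
      <= #|` A|%:R `^ (n%:R - delta) ->
    #|` [fset p in S `*` A `*` A | act p.1.1 p.1.2 == p.2]|%:R
      >= #|` S|%:R * #|` A|%:R `^ (1 - eps) ->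
  exists (H : {fset G}) (T : {fset X}),
    [/\ approx_subgroup (#|` A|%:R `^ delta) H,
        T `<=` A,
        #|` H|%:R <= #|` A|%:R `^ (n%:R + t + delta) /\
          (exists h : G,
             #|` H `&` [fset (h * s)%g | s in S]|%:R
               >= #|` A|%:R `^ (- delta) * #|` S|%:R),
        #|` T|%:R >= #|` A|%:R `^ (1 - delta) &
        #|` [fset act h x | h in H, x in T]|%:R <= #|` A|%:R `^ (1 + delta)].
Proof.
have [gam [tau [J [gam0 /andP[tau0 tau_le] tauE gamE JE]]]] :=
  exists_exponents n t_gt0 delta_gt0.
have [gam_d gam_1] : (365 + n%:R) * gam <= delta /\ (365 + n%:R) * gam <= 1.
  by move: gamE; rewrite le_min => /andP.
have ngam : 1 * gam <= n%:R * gam by rewrite ler_wpM2r ?(ltW gam0) // ler1n.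
set m := (2 * level J + 2)%N in tauE.
have C0 : 0 <= n%:R + t + 1 by rewrite !addr_ge0 // ltW.
have [eps /andP[eps0 eps_tau] threshold] := exists_threshold r_gt0 tau0 C0.
exists eps => // G X act actP S A [epsA AS _] stabA tripleA.
have [a aE] : exists a : R, a = #|` A|%:R by exists #|` A|%:R.
rewrite -!aE in epsA AS stabA tripleA *.
have a_ge0 : 0 <= a by rewrite aE.
have [a1 tau2 lna] := threshold a a_ge0 epsA.
have a0 : 0 < a := lt_le_trans ltr01 a1.
have aD x y : a `^ (x + y) = a `^ x * a `^ y by rewrite powRD // (gt_eqF a0) implybT.
have aX x k : (a `^ x) ^+ k = a `^ (x * k%:R) by rewrite powRrM powR_mulrn ?powR_ge0.
have a_le x y : x <= y -> a `^ x <= a `^ y by apply: ler_powR.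
have a_gt0 x : 0 < a `^ x by rewrite powR_gt0.
have [b bE] : exists b : R, b = a `^ (- tau) by exists (a `^ (- tau)).
have [K KE] : exists K : R, K = a `^ gam by exists (a `^ gam).
have b0 : 0 < b by rewrite bE.
have b2 : b <= 2^-1 by rewrite bE powRN lef_pV2 ?posrE ?a_gt0 ?ltr0n.
have b1 : b <= 1 by rewrite (le_trans b2) // invf_le1 ?ler1n ?ltr0n.
have K0 : 0 < K by rewrite KE.
(* The relation between [tau] and [m] makes the total loss [b ^+ m] equal to [a ^ (- gam / 2)], the
   inverse square root of [K]. *)
have bmE : b ^+ m = a `^ (- (gam / 2)) by rewrite bE aX mulNr tauE.
have Kb : K * (b ^+ m) ^+ 2 = 1.
  by rewrite bmE KE aX -aD -[RHS](powRr0 a); congr powR; field.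
have KX k : K ^+ k = a `^ (gam * k%:R) by rewrite KE.
have A0 : (0 < #|` A|)%N by rewrite -(ltr0n R) -aE.
have S0 : (0 < #|` S|)%N by rewrite -(ltr0n R) (lt_le_trans _ AS).
pose gen := generated_subgroup [set` S].
have gen_div g h : gen g -> gen h -> gen (g^-1 * h)%g by exact: generated_subgroup_div.
(* This is the stabiliser bound for popularity [a ^ (- gam / 2)], the smallest that occurs in the
   iteration. *)
pose M := a `^ (n%:R + t + n%:R * (gam / 2) + tau).
have boundY Y e : (e <= m)%N -> descendant act A gen S (b ^+ e) Y -> (size Y)%:R <= M.
  move=> em [uY genY ovY _].
  apply: (size_le_of_small_stab_powR actP gen_div aE a1 tau2 _ stabA uY genY) => [|g /ovY].
    by clear -tau_le gam_d ngam gam0; lra.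
  by rewrite -aE; apply: le_trans; rewrite ler_wpM2r // -bmE ler_wiXn2l // ltW.
(* The exponent in [M] is at most [n + t + 1], the constant for which the threshold on [a] was
   chosen. *)
have bM : b * (1 + ln M) < 1.
  rewrite -(ltr_pM2l (a_gt0 tau)) mulrA bE -aD addrN powRr0 mul1r mulr1.
  apply: le_lt_trans lna; rewrite lerD2l ln_powR ler_wpM2r ?ln_ge0 //.
  by clear -tau_le gam_1 ngam gam0; lra.
(* [gam / 2 * J] is at least [n + t + 2], and the surplus 2 covers [n * gam / 2 + 2 * tau]. *)
have JM : (b ^+ m) ^+ J * M < 1.
  rewrite bmE aX -aD; apply: (@le_lt_trans _ _ b).
    by rewrite bE a_le //; clear -tau_le gam_1 ngam gam0 JE; lra.
  by apply: le_lt_trans b2 _; clear; lra.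
have bb : 0 < b <= 2^-1 by rewrite b0.
have tripleS : b * #|` A|%:R * #|` S|%:R <=
    #|` [fset p in S `*` A `*` A | act p.1.1 p.1.2 == p.2]|%:R.
  apply: le_trans tripleA; rewrite -aE mulrC ler_wpM2l // bE.
  by rewrite -[X in _ * X]powRr1 // -aD addrC a_le // lerD2l lerN2.
have genS g : g \in S -> gen g by move=> gS; apply: sub_gen_smallest; exact: gS.
have [Y0 sY0 descY0] := descendant_init bb A0 S0 genS tripleS.
have [e [Y [D [em sY descY DK YD]]]] := exists_closed_descendant actP (fset_uniq A)
  A0 gen_div bb (erefl m) Kb boundY bM JM sY0 descY0.
have K2 : 2 <= K.
  by rewrite KE (le_trans tau2) // a_le //; clear -tau_le gam0; lra.
have Kbm : 1 <= K * b ^+ m.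
  by rewrite bmE KE -aD -[leLHS](powRr0 a) a_le //; clear -gam0; lra.
(* Half of the exponent [gam] pays for [b ^+ m]; the other half is at least [tau] and pays for the
   division by 2. *)
have be : K^-1 <= b ^+ e / 2.
  apply: (@le_trans _ _ (b ^+ m * b)).
    by rewrite bmE bE KE -aD -powRN a_le //; clear -tau_le gam0; lra.
  by rewrite ler_pM ?exprn_ge0 ?(ltW b0) // ler_wiXn2l // ltW.
have be1 : 0 < b ^+ e <= 1 by rewrite exprn_gt0 //= exprn_ile1 // ltW.
have YD' : (size Y)%:R ^+ 2 <=
    K * \sum_(g <- Y) (count (fun h => (g^-1 * h)%g \in D) Y)%:R.
  have := ler_wpM2r (exprn_ge0 2 (ler0n R (size Y))) Kbm.
  by rewrite mul1r -mulrA => /le_trans; apply; rewrite ler_wpM2l // ltW.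
have [H [T [[appH cH] TA [h hS] cT cHT]]] :=
  approx_subgroup_of_closed_descendant actP K2 be1 be sY descY DK YD'.
have YM := boundY _ _ em descY.
rewrite -aE in cT cHT.
exists H, T; split=> //.
- apply: approx_subgroup_le appH; rewrite KX a_le //.
  by clear -gam_d ngam gam0; lra.
(* For the size of [H], the excess over [n + t] is [90 * gam + n * gam / 2 + tau], at most
   [(365 + n) * gam] and so at most [delta]. *)
- split; last first.
    exists h; apply: le_trans hS; rewrite ler_wpM2r //.
    by rewrite KX -powRN a_le //; clear -gam_d ngam gam0; lra.
  apply: le_trans cH _; apply: le_trans (ler_wpM2l (exprn_ge0 _ (ltW K0)) YM) _.
  by rewrite KX -aD a_le //; clear -gam_d ngam gam0 tau_le; lra.
- apply: le_trans cT; rewrite addrC aD powRr1 // ler_wpM2r //.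
  by rewrite KE -powRN a_le //; clear -gam_d ngam gam0; lra.
- apply: le_trans cHT _; rewrite KX -[X in _ * X]powRr1 // -aD a_le //.
  by clear -gam_d ngam gam0; lra.
Qed.
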